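(* Let the parameters $\ell_1,\ell_2,\xi_1,\xi_2,\eta_1,\eta_2,\kappa>0$ and $M_1,M_2\in\mathbb{R}\setminus\{0\}$ satisfy $$(\eta_1-\xi_1,\eta_2-\xi_2)\neq(0,0),\qquad \eta_1\ge\xi_1,\quad \eta_2\ge\xi_2,$$ $$\Bigl(3+4\tfrac{\ell_2}{\ell_1}+\tfrac{\eta_2\ell_2^2}{\eta_1\ell_1^2}\Bigr)M_1-\Bigl(3+4\tfrac{\ell_1}{\ell_2}+\tfrac{\eta_1\ell_1^2}{\eta_2\ell_2^2}\Bigr)M_2\neq0 .$$ Fix an equilibrium $\mathbf{z}^e=(x^e,y^e,\theta^e,0)$ of the two-link swimmer control system (S) (defined in the context). Let $\mathcal{W}$ be a neighborhood of $\mathbf{z}^e$ in $\mathbb{R}^2\times S^1\times S^1$ and let $T,\varepsilon$ be positive numbers. Then there exists another neighborhood $\mathcal{V}\subset\mathcal{W}$ of $\mathbf{z}^e$ such that, for any $\mathbf{z}^i$ and $\mathbf{z}^f$ in $\mathcal{V}$, there exist bounded measurable functions $H_\parallel,H_\perp\in L^\infty([0,T],\mathbb{R})$ such that $$\|H_\perp\|_\infty<\varepsilon,\qquad \|H_\parallel\|_\infty<2\kappa\left|\frac{M_2+M_1}{M_2M_1}\right|+\varepsilon,$$ and, if $t\mapsto\mathbf{z}(t)=(x(t),y(t),\theta(t),\alpha(t))$ is the solution of (S) with these controls starting at $\mathbf{z}(0)=\mathbf{z}^i$, then $\mathbf{z}(T)=\mathbf{z}^f$ and $\mathbf{z}(t)\in\mathcal{W}$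 for all $t\in[0,T]$.
   Context: Write $\mathbf{R}_\varphi=\begin{pmatrix}\cos\varphi&-\sin\varphi\\ \sin\varphi&\cos\varphi\end{pmatrix}$, and let $\mathbf{I}_2$ be the $2\times2$ identity matrix. For positive parameters $\ell_i,\xi_i,\eta_i$ ($i=1,2$) define $$\mathbf{E}(\alpha)=\begin{pmatrix} -(\xi_1\ell_1+\xi_2\ell_2)\cos\alpha & -(\xi_1\ell_1+\eta_2\ell_2)\sin\alpha & \frac12\xi_1\ell_1\ell_2\sin\alpha & 0\\ (\eta_1\ell_1+\xi_2\ell_2)\sin\alpha & -(\eta_1\ell_1+\eta_2\ell_2)\cos\alpha & \frac12\eta_1\ell_1(\ell_1+\ell_2\cos\alpha) & \frac12\eta_1\ell_1^2\\ -\frac12\eta_1\ell_1^2\sin\alpha & \frac12(\eta_1\ell_1^2\cos\alpha-\eta_2\ell_2^2) & -\eta_1\ell_1^2\bigl(\frac14\ell_2\cos\alpha+\frac13\ell_1\bigr)-\frac1{12}\eta_2\ell_2^3 & -\frac13\eta_1\ell_1^3\\ 0 & -\frac12\eta_2\ell_2^2 & -\frac1{12}\eta_2\ell_2^3 & 0 \end{pmatrix}$$ and $$\mathbf{M}^h(\theta,\alpha)=\begin{pmatrix}\mathbf{R}_{\theta+\alpha}&0\\0&\mathbf{I}_2\end{pmatrix}\mathbf{E}(\alpha)\begin{pmatrix}\mathbf{R}_{-\theta}&0\\0&\mathbf{I}_2\end{pmatrix}.$$ These matrices are invertible for all $\theta,\alpha$. The two-link magneto-elastic swimmer control system, with state $\mathbf{z}=(x,y,\theta,\alpha)\in\mathbb{R}^2\times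 S^1\times S^1$ and controls $H_\parallel,H_\perp$, is $$\text{(S)}\qquad \mathbf{M}^h(\theta,\alpha)\begin{pmatrix}\dot x\\\dot y\\\dot\theta\\\dot\alpha\end{pmatrix}=\begin{pmatrix}0\\0\\-M_1(\cos\alpha\,H_\perp-\sin\alpha\,H_\parallel)-M_2H_\perp\\-\kappa\alpha-M_2H_\perp\end{pmatrix}.$$ Solutions are absolutely continuous curves satisfying (S) for almost every $t$. In the term $\kappa\alpha$, $\alpha(t)$ is the continuous real-valued determination of the angle with initial value in $(-\pi,\pi]$. The equilibria of (S) for zero controls are the points $(x^e,y^e,\theta^e,0)$ with $x^e,y^e,\theta^e$ arbitrary. *)

(* Defs.v *)
From HB Require Import structures.
From mathcomp Require Import all_boot all_order all_algebra generic_quotient.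
From mathcomp Require Import all_classical all_reals all_analysis.
Import Order.TTheory GRing.Theory Num.Theory.
Import numFieldNormedType.Exports.

Set Implicit Arguments.
Unset Strict Implicit.
Unset Printing Implicit Defensive.

Local Open Scope classical_set_scope.
Local Open Scope ring_scope.
Local Open Scope quotient_scope.

Section Circle.
Variable R : realType.

Definition angle_eq (a b : R) : bool :=
  `[< exists k : int, b - a = k%:~R * (pi *+ 2) >].

Lemma angle_eq_refl : reflexive angle_eq.
Proof. by move=> a; apply/asboolP; exists 0; rewrite subrr mul0r. Qed.

Lemma angle_eq_sym : symmetric angle_eq.
Proof.
have imp a b : angle_eq a b -> angle_eq b a.
  move=> /asboolP[k kE]; apply/asboolP; exists (- k).
  by rewrite -opprB kE rmorphN mulNr.
by move=> a b; apply/idP/idP; exact: imp.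
Qed.

Lemma angle_eq_trans : transitive angle_eq.
Proof.
move=> b a c /asboolP[k kE] /asboolP[l lE]; apply/asboolP; exists (l + k).
by rewrite rmorphD mulrDl -lE -kE addrA subrK.
Qed.

Canonical angle_equiv :=
  EquivRel angle_eq angle_eq_refl angle_eq_sym angle_eq_trans.

(* S^1 as R / 2 pi Z *)
Definition circle := quotient_topology {eq_quot angle_equiv}.

Definition angle (a : R) : circle := \pi_circle a.

Lemma angleP (a b : R) :
  angle a = angle b <-> exists k : int, b - a = k%:~R * (pi *+ 2).
Proof.
by split=> [/eqmodP/asboolP//|h]; apply/eqmodP/asboolP.
Qed.

End Circle.

Section AbsoluteContinuity.
Variable R : realType.

Definition abs_continuous (a b : R) (f : R -> R) : Prop :=
  forall eps : R, 0 < eps -> exists2 delta : R, 0 < delta &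
    forall (n : nat) (u v : 'I_n -> R),
      (forall i, [/\ a <= u i, u i <= v i & v i <= b]) ->
      trivIset [set: 'I_n] (fun i => `]u i, v i[%classic) ->
      \sum_(i < n) (v i - u i) < delta ->
      \sum_(i < n) `|f (v i) - f (u i)| < eps.

(* the norm of L^oo([0, T]): H is extended by 0 outside [0, T] *)
Definition Linfty_norm (T : R) (H : R -> R) : \bar R :=
  Lnorm (@lebesgue_measure R) +oo%E (EFin \o (H \_ `[0, T])).

End AbsoluteContinuity.

Section Swimmer.
Variable R : realType.

Record swimmer := Swimmer {
  ell1 : R; ell2 : R;
  xi1 : R; xi2 : R;
  eta1 : R; eta2 : R;
  kappa : R;
  M1 : R; M2 : R }.

Definition state : Type := (R * R * circle R * circle R)%type.

Definition mx_of_rows m n (s : seq (seq R)) : 'M[R]_(m, n) :=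
  \matrix_(i < m, j < n) (nth [::] s i)`_j.

Definition col4 (a b c d : R) : 'cV[R]_4 :=
  mx_of_rows 4 1 [:: [:: a]; [:: b]; [:: c]; [:: d]].

Definition rot (phi : R) : 'M[R]_2 :=
  mx_of_rows 2 2 [:: [:: cos phi; - sin phi]; [:: sin phi; cos phi]].

Definition rot_I2 (phi : R) : 'M[R]_4 :=
  block_mx (rot phi) 0 0 (1%:M : 'M[R]_2).

Definition Emx (P : swimmer) (al : R) : 'M[R]_4 :=
  let: Swimmer l1 l2 x1 x2 e1 e2 _ _ _ := P in
  let c := cos al in let s := sin al in
  mx_of_rows 4 4 [::
    [:: - (x1 * l1 + x2 * l2) * c;
        - (x1 * l1 + e2 * l2) * s;
        1 / 2 * x1 * l1 * l2 * s;
        0];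
    [:: (e1 * l1 + x2 * l2) * s;
        - (e1 * l1 + e2 * l2) * c;
        1 / 2 * e1 * l1 * (l1 + l2 * c);
        1 / 2 * e1 * l1 ^+ 2];
    [:: - (1 / 2) * e1 * l1 ^+ 2 * s;
        1 / 2 * (e1 * l1 ^+ 2 * c - e2 * l2 ^+ 2);
        - e1 * l1 ^+ 2 * (1 / 4 * l2 * c + 1 / 3 * l1)
          - 1 / 12 * e2 * l2 ^+ 3;
        - (1 / 3) * e1 * l1 ^+ 3];
    [:: 0;
        - (1 / 2) * e2 * l2 ^+ 2;
        - (1 / 12) * e2 * l2 ^+ 3;
        0] ].

Definition Mh (P : swimmer) (th al : R) : 'M[R]_4 :=
  rot_I2 (th + al) *m Emx P al *m rot_I2 (- th).

Definition rhs (P : swimmer) (al Hpar Hperp : R) : 'cV[R]_4 :=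
  col4 0 0
    (- M1 P * (cos al * Hperp - sin al * Hpar) - M2 P * Hperp)
    (- kappa P * al - M2 P * Hperp).

(* x, y, th, al are real-valued functions; th and al are continuous
   determinations of the two angles, al being the one used in kappa * alpha *)
Definition satisfies_S (P : swimmer) (T : R) (Hpar Hperp : R -> R)
    (x y th al : R -> R) : Prop :=
  {ae @lebesgue_measure R, forall t : R, t \in `]0, T[ ->
    [/\ derivable x t 1, derivable y t 1,
        derivable th t 1, derivable al t 1 &
        Mh P (th t) (al t) *m col4 (derive1 x t) (derive1 y t) (derive1 th t)
                              (derive1 al t)
        = rhs P (al t) (Hpar t) (Hperp t)]}.

(* A curve in R^2 x S^1 x S^1 is absolutely continuous when its continuous lift
   to R^4 is; the lift is normalised by al 0 \in ]-pi, pi] (the choice of lift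
   of theta is irrelevant, as Mh is 2 pi-periodic in theta). *)
Definition solution (P : swimmer) (T : R) (Hpar Hperp : R -> R)
    (z : R -> state) : Prop :=
  exists x y th al : R -> R,
    [/\ forall t, t \in `[0, T] -> z t = (x t, y t, angle (th t), angle (al t)),
        [/\ abs_continuous 0 T x, abs_continuous 0 T y,
            abs_continuous 0 T th & abs_continuous 0 T al],
        al 0 \in `]- pi, pi] &
        satisfies_S P T Hpar Hperp x y th al].

End Swimmer.

(* Main.v *)
Require Import Defs.
From HB Require Import structures.
From mathcomp Require Import all_boot all_order all_algebra.
From mathcomp Require Import all_classical all_reals all_analysis.
From mathcomp Require Import measurable_realfun ess_sup_inf ring lra.
Import Order.TTheory GRing.Theory Num.Theory.
Import numFieldNormedType.Exports.
Local Open Scope classical_set_scope.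
Local Open Scope ring_scope.

(** Write u, w for the velocity of the swimmer in the frame of its second link,
om for the derivative of theta and nu for that of alpha.

The first two equations of the system carry no control: they say that the total
force vanishes, and they give (u, w) as a linear function of (om, nu) that
depends on alpha only ([bodyU], [bodyW]). The position is therefore obtained by
quadrature along the curve (theta, alpha). The two remaining equations can be
solved for the fields. The last one gives the transverse field, which is small
when alpha, om and nu are small. Once it is eliminated, the equation for the
torque on the first link reads

  M1 sin(alpha) Hpar = balance - kappa alpha (1 + (M1 / M2) cos(alpha)),

where balance ([torque_balance]) is linear in (om, nu). The elastic term
contributes about kappa |M1 + M2| / |M1 M2| to Hpar, and the bound of the
theorem leaves a factor 2 to absorb the ratio alpha / sin(alpha). The balance
must be O(sin alpha) times a small number. The nondegeneracy hypothesis says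
that the coefficient of om in it does not vanish at alpha = 0, so the curves with

  alpha' = v,   theta' = c v + sin(alpha) p

have this property for one constant c ([gait_slope]) and arbitrary small v and p
([controls_small]). On such curves the swimmer behaves like a system without
drift, whose two inputs v and p are free.

This system can be steered by hand. With p = 0 the shape changes; with v = 0 the
swimmer turns with a frozen shape. Bending from 0 to a, turning by b and
straightening amounts to a rotation by b about a point attached to the body, the
pivot of a ([reach_spin]). The anisotropy of the drag makes the pivot move with a
([is_derive_pivotY]), and rotations by -b/2, b, -b/2 about two distinct pivots
compose to a translation ([reach_translate]). Conjugation by a small rotation
gives a translation in a second direction, so that all small displacements are
reached, in 29 phases of equal duration ([reach_near]). No differential equation
has to be solved: every curve is explicit up to one planar primitive ([shape_path]).

The statement is about every solution with the chosen fields, so uniqueness is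
needed as well. The power dissipated by the drag is a positive definite quadratic
form of the velocities ([power_balance]). Hence the equations determine the
velocities, with a Lipschitz dependence on alpha ([velocity_lipschitz]), and the
difference of the angles alpha of two solutions satisfies |d'| <= K |d| almost
everywhere. Gronwall's lemma for absolutely continuous functions
([abs_continuous_gronwall0]) rests on the fact that such a function with
nonpositive derivative almost everywhere is nonincreasing
([abs_continuous_derive_le0]), which is proved by a gauge argument. *)

Set Implicit Arguments.
Unset Strict Implicit.
Unset Printing Implicit Defensive.

(** * Absolutely continuous functions and their derivatives almost everywhere *)

(** Induction along an interval, in the spirit of Cousin's lemma: each point s
may impose its own step size, but a step only has to straddle s. The supremum of
the points that are reached is itself straddled by a step. *)
Lemma gauge_induction (R : realType) (a b : R) (P : R -> Prop) :
  a <= b -> P a ->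
  (forall s, a <= s <= b -> exists2 d, 0 < d &
     forall t t', a <= t <= s -> s <= t' <= b -> s - d < t -> t' < s + d ->
     P t -> P t') ->
  P b.
Proof.
move=> ab Pa step.
pose S := [set t | a <= t <= b /\ P t].
have Sa : S a by split; rewrite ?lexx.
have ubS : ubound S b by move=> t [] /andP[].
have hS : has_sup S by split; [exists a|exists b].
have as_ : a <= sup S by exact: sup_upper_bound.
have sb : sup S <= b by apply: ge_sup => //; exists a.
have /step[d d0 hd] : a <= sup S <= b by rewrite as_.
have [t [/andP[at_ tb] Pt] ht] := sup_adherent d0 hS.
have ts : t <= sup S by apply: sup_upper_bound => //; split => //; rewrite at_.
have ext t' : sup S <= t' <= b -> t' < sup S + d -> P t'.
  by move=> st' t'd; apply: (hd t) => //; rewrite at_.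
have [sbE|] := eqVneq (sup S) b.
  by apply: ext; rewrite ?sb ?lexx// -sbE ltrDl.
move=> neq; have ltsb : sup S < b by rewrite lt_neqAle neq.
pose t' := Num.min b (sup S + d / 2).
have st' : sup S < t' by rewrite lt_min ltsb ltrDl divr_gt0.
have t'b : t' <= b by rewrite ge_min lexx.
have : t' <= sup S.
  apply: sup_upper_bound => //; split; first by rewrite t'b (le_trans as_)// ltW.
  apply: ext; first by rewrite (ltW st').
  by rewrite gt_min ltrD2l ltr_pdivrMr// mulr_natr mulr2n ltrDl d0 orbT.
by rewrite leNgt st'.
Qed.

Lemma is_derive_near (R : realType) (f : R -> R) (s df e : R) :
  is_derive s 1 f df -> 0 < e ->
  exists2 d, 0 < d & forall t, `|t - s| < d ->
    `|f t - f s - df * (t - s)| <= e * `|t - s|.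
Proof.
move=> [dfs dfE] e0.
have cvgd : h^-1 *: (f (h + s) - f s) @[h --> 0^'] --> df.
  rewrite -dfE; have := dfs; rewrite /derivable /derive.
  by under eq_fun do rewrite scaler1.
have /cvgrPdist_lt/(_ _ e0) := cvgd.
move=> /nbhs_ballP[d /= d0 hd]; exists d => // t td.
have [->|ts] := eqVneq t s; first by rewrite !subrr mulr0 subrr normr0 mulr0.
have ts0 : t - s != 0 by rewrite subr_eq0.
have : `|df - (t - s)^-1 * (f (t - s + s) - f s)| < e.
  by apply: hd => //; rewrite -ball_normE/= sub0r normrN.
rewrite subrK => /ltW /(ler_wpM2r (normr_ge0 (t - s))); rewrite -normrM.
by rewrite mulrBl mulrAC mulVf// mul1r distrC.
Qed.

(** The increment over an interval that straddles s, rather than one that starts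
at s, is what [gauge_induction] needs. *)
Lemma derive_le0_increment (R : realType) (f : R -> R) (s e : R) :
  derivable f s 1 -> derive1 f s <= 0 -> 0 < e ->
  exists2 d, 0 < d & forall u v, s - d < u -> u <= s -> s <= v -> v < s + d ->
    f v - f u <= e * (v - u).
Proof.
move=> /derivableP dfs; rewrite derive1E; move: ('D_1 f s) dfs => D dfs D0 e0.
have [d d0 hd] := is_derive_near dfs e0.
exists d => // u v su us sv vd.
have := hd u; rewrite distrC ger0_norm ?subr_ge0//.
move=> /(_ ltac:(lra)); rewrite ler_norml => /andP[hu _].
have := hd v; rewrite ger0_norm ?subr_ge0//.
move=> /(_ ltac:(lra)); rewrite ler_norml => /andP[_ hv].
have : 0 <= - D * (v - u) by rewrite mulr_ge0//; lra.
lra.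
Qed.

Lemma negligible_open_cover (R : realType) (N : set R) (e : R) :
  (@lebesgue_measure R).-negligible N -> 0 < e ->
  exists U : set R, [/\ open U, N `<=` U & (lebesgue_measure U < e%:E)%E].
Proof.
move=> [B [mB /= B0 NB]] e0.
have [|U [oU BU mU]] := lebesgue_regularity_outer mB _ e0.
  by rewrite [ltLHS](_ : _ = 0%E) ?ltry//; exact: B0.
exists U; split => //; first exact: subset_trans BU.
have mU' := open_measurable oU.
rewrite -(setDUK BU) measureU//=; [|exact: measurableD|exact: setDIK].
by rewrite [X in (X + _)%E](_ : _ = 0%E) ?add0e//; exact: B0.
Qed.

Lemma measure_itv_extend (R : realType) (U : set R) (a t t' : R) :
  open U -> a <= t -> t <= t' -> `]t, t'] `<=` U ->
  (lebesgue_measure (U `&` `[a, t]) + (t' - t)%:E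
   <= lebesgue_measure (U `&` `[a, t']))%E.
Proof.
move=> oU at_ tt' tU; have mU := open_measurable oU.
have -> : (t' - t)%:E = lebesgue_measure (`]t, t']%classic : set R).
  rewrite lebesgue_measure_itv/= lte_fin EFinB.
  by case: ltgtP tt' => // -> _; rewrite subee.
rewrite -measureU//=; last 2 first.
- exact: measurableI.
- apply/seteqP; split => // x /= [[_]]; rewrite !in_itv/= => /andP[_ xt] /andP[tx _].
  by move: (lt_le_trans tx xt); rewrite ltxx.
apply: le_measure; rewrite ?inE.
- by apply: measurableU => //; exact: measurableI.
- exact: measurableI.
move=> x /= [[Ux]|xt]; rewrite /= !in_itv/=.
  by move=> /andP[-> xt]; split => //=; exact: le_trans xt tt'.
split; first exact: tU.
by move: xt; rewrite /= in_itv/= => /andP[/ltW tx ->]; rewrite (le_trans at_ tx).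
Qed.

Lemma negligible_seq (R : realType) (s : seq R) :
  (@lebesgue_measure R).-negligible [set` s].
Proof.
elim: s => [|x s IH]; first by rewrite set_nil; exact: negligible_set0.
have -> : [set` x :: s] = [set x] `|` [set` s].
  apply/seteqP; split => y /=; first by rewrite inE => /predU1P.
  by case=> [->|ys]; rewrite inE ?eqxx ?ys ?orbT.
apply: negligibleU IH.
by exists [set x]; split => //; exact: lebesgue_measure_set1.
Qed.

(** Cover the exceptional null set by an open set U so small that absolute
continuity makes the total increment of f over disjoint intervals inside U small.
Outside the exceptional set f increases by at most e1 times the length of the
step. [gauge_induction] then runs over [a, b] and records in a list the steps
taken around exceptional points. *)
Lemma abs_continuous_derive_le0 (R : realType) (a b : R) (f : R -> R) :
  a <= b -> abs_continuous a b f ->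
  {ae @lebesgue_measure R, forall t, t \in `]a, b[ ->
     derivable f t 1 /\ derive1 f t <= 0} ->
  f b <= f a.
Proof.
move=> ab acf aef; rewrite -subr_le0; apply/ler_addgt0Pr => e e0.
rewrite add0r.
pose e1 := e / 2 / (b - a + 1).
have ba1 : 0 < b - a + 1 by rewrite ltr_wpDl// subr_ge0.
have e10 : 0 < e1 by rewrite !divr_gt0.
have e20 : 0 < e / 2 by rewrite divr_gt0.
have [d d0 hd] := acf _ e20.
(* The endpoints count as exceptional, since nothing is known about them. *)
pose N := ~` [set t | t \in `]a, b[ -> derivable f t 1 /\ derive1 f t <= 0]
  `|` [set` [:: a; b]].
have N0 : (@lebesgue_measure R).-negligible N.
  apply: negligibleU; first exact: aef.
  exact: negligible_seq.
have [U [oU NU mU]] := negligible_open_cover N0 d0.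
(* The total length of the recorded intervals is compared to the measure of U up
   to t, which grows with each of them. *)
pose P t := exists (n : nat) (u v : nat -> R),
  [/\ forall i, (i < n)%N -> [/\ a <= u i, u i <= v i & v i <= t],
      forall i j, (i < j < n)%N -> v i <= u j,
      ((\sum_(i < n) (v i - u i))%:E <= lebesgue_measure (U `&` `[a, t]))%E &
      f t - f a <= e1 * (t - a) + \sum_(i < n) `|f (v i) - f (u i)|].
have [n [u [v [uv dis len fba]]]] : P b.
  apply: (@gauge_induction _ a) => //.
    exists 0%N, (fun=> 0), (fun=> 0); split => //.
    - by rewrite big_ord0 measure_ge0.
    - by rewrite big_ord0 !subrr mulr0 addr0.
  move=> s /andP[as_ sb]; have [sN|sN] := pselect (N s); last first.
    have [sab fs] : a < s < b /\ (derivable f s 1 /\ derive1 f s <= 0).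
      have sab : a < s < b.
        rewrite !lt_neqAle as_ sb !andbT; apply/andP; split.
          by apply/eqP => sE; apply: sN; right; rewrite /= sE mem_head.
        by apply/eqP => sE; apply: sN; right; rewrite /= sE !inE eqxx orbT.
      split => //; apply: contrapT => h; apply: sN; left => /=.
      by move=> /(_ _); rewrite in_itv/= => /(_ sab).
    have [d1 d10 hd1] := derive_le0_increment fs.1 fs.2 e10.
    exists d1 => // t t' /andP[at_ ts] /andP[st' t'b] std t'sd.
    move=> [n [u [v [uv dis len fba]]]]; exists n, u, v; split => //.
    - by move=> i /uv[? ? vt]; split => //; rewrite (le_trans vt)// (le_trans ts).
    - apply: le_trans len _; apply: le_measure; rewrite ?inE.
      + by apply: measurableI => //; exact: open_measurable.
      + by apply: measurableI => //; exact: open_measurable.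
      apply: setIS => x /=; rewrite !in_itv/= => /andP[-> xt] /=.
      by rewrite (le_trans xt)// (le_trans ts).
    - have := hd1 t t' std ts st' t'sd; lra.
  (* s is exceptional: the step is appended to the record. *)
  have /NU Us := sN.
  have /nbhs_ballP[d1 /= d10 hd1] := open_nbhs_nbhs (conj oU Us).
  exists d1 => // t t' /andP[at_ ts] /andP[st' t'b] std t'sd.
  move=> [n [u [v [uv dis len fba]]]].
  have tt' : t <= t' by exact: le_trans st'.
  exists n.+1, (fun i => if i == n then t else u i),
    (fun i => if i == n then t' else v i).
  have sumE (F : R -> R -> R) :
    \sum_(i < n.+1) F (if i == n :> nat then t' else v i)
                      (if i == n :> nat then t else u i)
    = \sum_(i < n) F (v i) (u i) + F t' t.
    rewrite big_ord_recr/= eqxx; congr (_ + _).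
    by apply: eq_bigr => i _; rewrite ltn_eqF.
  split.
  - move=> i; rewrite ltnS leq_eqVlt; case: eqVneq => [_ _|_ /= /uv[? ? vt]] //.
    by split => //; exact: le_trans tt'.
  - move=> i j /andP[ij]; rewrite ltnS leq_eqVlt; case: (eqVneq j n) => [jn _|_ /= jn].
      by rewrite ltn_eqF -?jn//; have [|] := uv i; rewrite -?jn.
    by rewrite ltn_eqF ?(ltn_trans ij)//; apply: dis; rewrite ij.
  - rewrite (sumE (fun x y => x - y)) EFinD.
    apply: le_trans (measure_itv_extend oU at_ tt' _).
      by rewrite leeD2r.
    move=> x /=; rewrite in_itv/= => /andP[tx xt']; apply: hd1.
    rewrite -ball_normE/= ltr_distlC; apply/andP; split; first by apply: lt_trans tx.
    by apply: le_lt_trans xt' _.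
  - rewrite (sumE (fun x y => `|f x - f y|)).
    have := ler_norm (f t' - f t); have : 0 <= e1 * (t' - t).
      by rewrite mulr_ge0 ?subr_ge0// ltW.
    lra.
apply: (le_trans fba).
have le1 : e1 * (b - a) <= e / 2.
  rewrite /e1 -mulrA ler_piMr ?(ltW e20)// mulrC ler_pdivrMr// mul1r; lra.
have len' : \sum_(i < n) (v i - u i) < d.
  rewrite -lte_fin; apply: le_lt_trans len _; apply: le_lt_trans mU.
  apply: le_measure; rewrite ?inE//; last exact: open_measurable.
  by apply: measurableI => //; exact: open_measurable.
have := hd n (fun i => u i) (fun i => v i); move=> /(_ _ _ len').
move=> /(_ (fun i => uv i (ltn_ord i)))/(_ _)/ltW H.
rewrite [leRHS](splitr e) lerD// H//.
apply/trivIsetP => i j _ _ ij.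
wlog ltij : i j ij / (i < j)%N.
  move=> W; have [|ji|/val_inj] := ltngtP i j.
  - exact: W.
  - by rewrite setIC; apply: W => //; rewrite eq_sym.
  - by move=> E; rewrite E eqxx in ij.
apply/seteqP; split => // x /= []; rewrite !in_itv/= => /andP[_ xv] /andP[ux _].
have : v i <= u j by apply: dis; rewrite ltij ltn_ord.
by move=> /(lt_le_trans xv)/(lt_trans ux); rewrite ltxx.
Qed.
(** Rules of derivation in a form that applies directly to explicit expressions of
the variable. *)
Lemma is_derive_cstr (R : realType) (t c : R) : is_derive t 1 (fun=> c : R) 0.
Proof. exact: is_derive_cst. Qed.

Lemma is_derive_idr (R : realType) (t : R) : is_derive t 1 (fun s : R => s) 1.
Proof. exact: is_derive_id. Qed.

Lemma is_deriveDr (R : realType) (f g : R -> R) (t a b : R) :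
  is_derive t 1 f a -> is_derive t 1 g b ->
  is_derive t 1 (fun s => f s + g s) (a + b).
Proof. exact: is_deriveD. Qed.

Lemma is_deriveNr (R : realType) (f : R -> R) (t a : R) :
  is_derive t 1 f a -> is_derive t 1 (fun s => - f s) (- a).
Proof. exact: is_deriveN. Qed.

Lemma is_deriveMr (R : realType) (f g : R -> R) (t a b : R) :
  is_derive t 1 f a -> is_derive t 1 g b ->
  is_derive t 1 (fun s => f s * g s) (a * g t + f t * b).
Proof.
move=> df dg; apply: is_derive_eq (is_deriveM df dg) _.
by rewrite addrC !/(_ *: _)/= (mulrC a).
Qed.

Lemma is_deriveVr (R : realType) (f : R -> R) (t a : R) :
  f t != 0 -> is_derive t 1 f a ->
  is_derive t 1 (fun s => (f s)^-1) (- a / f t ^+ 2).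
Proof.
move=> ft0 df; apply: is_derive_eq (is_deriveV ft0 df) _.
by rewrite /(_ *: _)/= mulNr -mulrN mulrC.
Qed.

Lemma is_derive_comp_fun (R : realType) (h f : R -> R) (t a b : R) :
  is_derive (f t) 1 h b -> is_derive t 1 f a ->
  is_derive t 1 (fun s => h (f s)) (b * a).
Proof. exact: is_derive1_comp. Qed.

Lemma is_derive_sin_comp (R : realType) (f : R -> R) (t a : R) :
  is_derive t 1 f a -> is_derive t 1 (fun s => sin (f s)) (cos (f t) * a).
Proof. exact: is_derive_comp_fun. Qed.

Lemma is_derive_cos_comp (R : realType) (f : R -> R) (t a : R) :
  is_derive t 1 f a -> is_derive t 1 (fun s => cos (f s)) (- sin (f t) * a).
Proof. exact: is_derive_comp_fun. Qed.

Lemma is_derive_exp_comp (R : realType) (f : R -> R) (t a : R) :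
  is_derive t 1 f a -> is_derive t 1 (fun s => expR (f s)) (expR (f t) * a).
Proof. exact: is_derive_comp_fun. Qed.

Lemma is_derive_subst (R : realType) (f : R -> R) (t a b : R) :
  is_derive t 1 f a -> a = b -> is_derive t 1 f b.
Proof. by move=> df <-. Qed.

(** Hypotheses come first, so that derivatives of opaque subterms may be supplied
in the context. *)
Ltac derivation := repeat first
  [ eassumption | eapply is_derive_cstr | eapply is_derive_idr
  | eapply is_deriveDr | eapply is_deriveNr | eapply is_deriveMr
  | eapply is_derive_sin_comp | eapply is_derive_cos_comp ].

Lemma is_derive_lipschitz (R : realType) (f df : R -> R) (a b K : R) :
  (forall t, a <= t <= b -> is_derive t 1 f (df t)) ->
  (forall t, a <= t <= b -> `|df t| <= K) ->
  forall s t, a <= s <= b -> a <= t <= b -> `|f t - f s| <= K * `|t - s|.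
Proof.
move=> fdf dfK s t; wlog st : s t / s <= t.
  move=> W sab tab; have [st|/ltW ts] := leP s t; first exact: W.
  by rewrite distrC (distrC t); exact: W.
move=> /andP[as_ sb] /andP[at_ tb].
have sub x : s <= x <= t -> a <= x <= b.
  by move=> /andP[sx xt]; rewrite (le_trans as_)// (le_trans xt).
have [||c] := @MVT_segment _ f df s t st.
- move=> x; rewrite in_itv/= => /andP[sx xt].
  by apply: fdf; apply: sub; rewrite !ltW.
- apply: derivable_within_continuous => x; rewrite in_itv/= => /sub /fdf.
  by case.
rewrite in_itv/= => /sub cab ->.
by rewrite normrM ler_wpM2r// dfK.
Qed.

Lemma abs_continuousS (R : realType) (a b c d : R) (f : R -> R) :
  a <= c -> d <= b -> abs_continuous a b f -> abs_continuous c d f.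
Proof.
move=> ac db acf e /acf[dl dl0 h]; exists dl => // n u v uv; apply: h => i.
have [cu uv' vd] := uv i.
by split=> //; [exact: le_trans ac cu|exact: le_trans vd db].
Qed.

Lemma lipschitz_abs_continuous (R : realType) (a b K : R) (f : R -> R) :
  (forall s t, a <= s <= b -> a <= t <= b -> `|f t - f s| <= K * `|t - s|) ->
  abs_continuous a b f.
Proof.
move=> lf e e0; pose K' := `|K| + 1.
have K'0 : 0 < K' by rewrite ltr_wpDl.
exists (e / K') => [|n u v uv _]; first exact: divr_gt0.
rewrite ltr_pdivlMr// mulrC => /(le_lt_trans _); apply.
rewrite mulr_sumr; apply: ler_sum => i _.
have [au uv' vb] := uv i.
apply: le_trans (lf _ _ _ _) _; rewrite ?au ?vb ?(le_trans uv') ?(le_trans au)//.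
rewrite ger0_norm ?subr_ge0// ler_wpM2r ?subr_ge0// /K'.
by have := ler_norm K; lra.
Qed.

Lemma abs_continuous_unif (R : realType) (a b : R) (f : R -> R) :
  abs_continuous a b f -> forall e, 0 < e -> exists2 d, 0 < d &
  forall s t, a <= s -> s <= t -> t <= b -> t - s < d -> `|f t - f s| < e.
Proof.
move=> acf e /acf[d d0 h]; exists d => // s t as_ st tb std.
have := h 1%N (fun=> s) (fun=> t) (fun=> And3 as_ st tb).
rewrite !big_ord_recl !big_ord0 !addr0; apply => //.
by apply/trivIsetP => i j _ _; rewrite !ord1.
Qed.

Lemma abs_continuous_bounded (R : realType) (a b : R) (f : R -> R) :
  abs_continuous a b f -> exists M, forall t, a <= t <= b -> `|f t| <= M.
Proof.
move=> acf; have [ab|ba] := leP a b; last first.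
  by exists 0 => t /andP[at_ /(le_trans at_)]; rewrite leNgt ba.
pose P t := exists M, forall s, a <= s <= t -> `|f s| <= M.
apply: (@gauge_induction R a b P) => //.
  by exists `|f a| => s; rewrite -eq_le => /eqP ->.
have [d d0 hd] := abs_continuous_unif acf ltr01.
move=> s _; exists (d / 2); rewrite ?divr_gt0//.
move=> t t' /andP[at_ ts] /andP[st' t'b] sdt t'sd [M hM].
exists (M + 1) => x /andP[ax xt'].
have [xt|tx] := leP x t.
  by apply: le_trans (hM _ _) _; rewrite ?ax ?xt// lerDl.
have ft : `|f t| <= M by apply: hM; rewrite at_ lexx.
have := hd t x at_ (ltW tx) (le_trans xt' t'b).
move=> /(_ ltac:(lra))/ltW fxt; rewrite -(subrK (f t) (f x)) addrC.
by apply: le_trans (ler_normD _ _) _; rewrite lerD.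
Qed.

Lemma abs_continuousN (R : realType) (a b : R) (f : R -> R) :
  abs_continuous a b f -> abs_continuous a b (fun t => - f t).
Proof.
move=> acf e /acf[d d0 h]; exists d => // n u v uv tr s.
rewrite (eq_bigr (fun i => `|f (v i) - f (u i)|)) ?h// => i _.
by rewrite -normrN; congr `|_|; ring.
Qed.

Lemma abs_continuousD (R : realType) (a b : R) (f g : R -> R) :
  abs_continuous a b f -> abs_continuous a b g ->
  abs_continuous a b (fun t => f t + g t).
Proof.
move=> acf acg e e0.
have e20 : 0 < e / 2 by rewrite divr_gt0.
have [d d0 hf] := acf _ e20; have [d' d'0 hg] := acg _ e20.
exists (Num.min d d') => [|n u v uv tr]; first by rewrite lt_min d0.
rewrite lt_min => /andP[sd sd'].
rewrite (splitr e); apply: le_lt_trans (ltrD (hf _ _ _ uv tr sd) (hg _ _ _ uv tr sd')).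
rewrite -big_split/=; apply: ler_sum => i _.
by apply: le_trans (ler_normD _ _); rewrite le_eqVlt; apply/orP; left; apply/eqP; congr `|_|; ring.
Qed.

Lemma abs_continuousM (R : realType) (a b : R) (f g : R -> R) :
  abs_continuous a b f -> abs_continuous a b g ->
  abs_continuous a b (fun t => f t * g t).
Proof.
move=> acf acg e e0.
have [M hM] := abs_continuous_bounded acf.
have [M' hM'] := abs_continuous_bounded acg.
pose K := `|M| + `|M'| + 1.
have K0 : 0 < K by rewrite ltr_wpDl// addr_ge0.
have e20 : 0 < e / 2 / K by rewrite !divr_gt0.
have [d d0 hf] := acf _ e20; have [d' d'0 hg] := acg _ e20.
exists (Num.min d d') => [|n u v uv tr]; first by rewrite lt_min d0.
rewrite lt_min => /andP[sd sd'].
have := ltrD (hf _ _ _ uv tr sd) (hg _ _ _ uv tr sd').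
have -> : e / 2 / K + e / 2 / K = e / K by field; rewrite gt_eqF.
rewrite ltr_pdivlMr// => /(le_lt_trans _); apply.
rewrite -big_split/= mulr_suml; apply: ler_sum => i _.
have [au uv' vb] := uv i.
have fb : `|f (v i)| <= K.
  rewrite (le_trans (hM _ _)) ?vb ?(le_trans au)//.
  by have := ler_norm M; have := normr_ge0 M'; rewrite /K; lra.
have gb : `|g (u i)| <= K.
  rewrite (le_trans (hM' _ _)) ?au ?(le_trans uv')//.
  by have := ler_norm M'; have := normr_ge0 M; rewrite /K; lra.
have -> : f (v i) * g (v i) - f (u i) * g (u i) =
  (f (v i) - f (u i)) * g (u i) + f (v i) * (g (v i) - g (u i)) by ring.
apply: le_trans (ler_normD _ _) _; rewrite !normrM mulrDl lerD//.
  by rewrite ler_wpM2l.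
by rewrite mulrC ler_wpM2l.
Qed.

Lemma ae_impl (R : realType) (P Q : R -> Prop) :
  {ae @lebesgue_measure R, forall t, P t} -> (forall t, P t -> Q t) ->
  {ae @lebesgue_measure R, forall t, Q t}.
Proof. by move=> aeP PQ; apply: negligibleS aeP => t /= nQ /PQ. Qed.

Lemma ae_and (R : realType) (P Q : R -> Prop) :
  {ae @lebesgue_measure R, forall t, P t} ->
  {ae @lebesgue_measure R, forall t, Q t} ->
  {ae @lebesgue_measure R, forall t, P t /\ Q t}.
Proof.
move=> aeP aeQ; apply: negligibleS (negligibleU aeP aeQ) => t /= nPQ.
by apply: contrapT => /not_orP[/contrapT Pt /contrapT Qt]; exact: nPQ.
Qed.

(** Apply [abs_continuous_derive_le0] to both differences. *)
Lemma abs_continuous_eq_derive (R : realType) (a b : R) (f g : R -> R) :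
  abs_continuous a b f -> abs_continuous a b g ->
  {ae @lebesgue_measure R, forall t, t \in `]a, b[ ->
     [/\ derivable f t 1, derivable g t 1 & derive1 f t = derive1 g t]} ->
  forall t, a <= t <= b -> f t - f a = g t - g a.
Proof.
move=> + + + t /andP[at_ tb].
have le (F G : R -> R) : abs_continuous a b F -> abs_continuous a b G ->
    {ae @lebesgue_measure R, forall t, t \in `]a, b[ ->
     [/\ derivable F t 1, derivable G t 1 & derive1 F t = derive1 G t]} ->
     F t - F a <= G t - G a.
  move=> acF acG FG.
  have : F t + - G t <= F a + - G a.
    apply: (@abs_continuous_derive_le0 R a t (fun t => F t + - G t)) => //.
      apply: (@abs_continuousS _ a b) => //.
      by apply: abs_continuousD => //; exact: abs_continuousN.
    apply: (ae_impl FG) => s h; rewrite in_itv/= => /andP[as_ st].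
    have [|dF dG eqFG] := h; first by rewrite in_itv/= as_ (lt_le_trans st).
    have /derivableP dF' := dF; have /derivableP dG' := dG.
    have D : is_derive s 1 (fun t => F t + - G t) ('D_1 F s + - 'D_1 G s).
      by apply: is_deriveD.
    split; first by case: D.
    by rewrite derive1E derive_val -!derive1E eqFG subrr.
  by lra.
move=> acf acg fg; apply/eqP; rewrite eq_le !le//.
by apply: (ae_impl fg) => s h /h[? ? ?].
Qed.

(** The function f^2 exp(-2 L t) has nonpositive derivative almost everywhere,
vanishes at a and is nonnegative. *)
Lemma abs_continuous_gronwall0 (R : realType) (a b L : R) (f : R -> R) :
  abs_continuous a b f -> f a = 0 ->
  {ae @lebesgue_measure R, forall t, t \in `]a, b[ ->
     derivable f t 1 /\ `|derive1 f t| <= L * `|f t|} ->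
  forall t, a <= t <= b -> f t = 0.
Proof.
move=> acf fa0 aef t /andP[at_ tb].
pose E (t : R) : R := expR (- (2 * L) * t).
pose F (t : R) : R := f t * f t * E t.
have dE (s : R) : is_derive s 1 E (E s * (- (2 * L))).
  apply: is_derive_exp_comp; by eapply is_derive_subst; [derivation|move=> /=; ring].
have Egt0 (s : R) : 0 < E s by exact: expR_gt0.
have acE : abs_continuous a b E.
  apply: (@lipschitz_abs_continuous _ _ _
      (expR (`|2 * L| * (`|a| + `|b|)) * `|2 * L|)).
  apply: is_derive_lipschitz => // s /andP[as_ sb].
  rewrite normrM normrN ler_wpM2r// ger0_norm ?expR_ge0// /E ler_expR.
  have sab : `|s| <= `|a| + `|b|.
    have := ler_norm b; have := ler_norm (- a); rewrite normrN => ? ?.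
    have := normr_ge0 a; have := normr_ge0 b => ? ?.
    by rewrite ler_norml; apply/andP; split; lra.
  apply: le_trans (ler_norm _) _.
  by rewrite normrM normrN ler_wpM2l.
suff : F t <= F a.
  rewrite /F fa0 !mul0r -expr2 => Ft; apply/eqP.
  rewrite -sqrf_eq0 eq_le sqr_ge0 andbT.
  by rewrite -(ler_pM2r (Egt0 t)) mul0r.
apply: (@abs_continuous_derive_le0 R a t F) => //.
  apply: (@abs_continuousS _ a b) => //.
  by apply: abs_continuousM => //; exact: abs_continuousM.
apply: (ae_impl aef) => s h; rewrite in_itv/= => /andP[as_ st].
have [|df dfL] := h; first by rewrite in_itv/= as_ (lt_le_trans st).
have /derivableP df' := df.
have D := is_deriveMr (is_deriveMr df' df') (dE s).
split; first by case: D.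
rewrite derive1E derive_val -derive1E.
set y := derive1 f s in dfL *.
have ff' : y * f s <= L * f s * f s.
  apply: le_trans (ler_norm _) _; rewrite normrM.
  apply: le_trans (ler_wpM2r (normr_ge0 _) dfL) _.
  by rewrite -!mulrA -normrM ger0_norm// -expr2 sqr_ge0.
have -> : (y * f s + f s * y) * E s + f s * f s * (E s * - (2 * L)) =
  2 * E s * (y * f s - L * f s * f s) by ring.
by rewrite pmulr_rle0 ?subr_le0// mulr_gt0.
Qed.
(** * The circle and the neighborhoods in the state space *)

Lemma angle_surj (R : realType) (c : circle R) : exists a, c = angle a.
Proof. by exists (repr c); rewrite /angle reprK. Qed.

Lemma angleDpi (R : realType) (a : R) (k : int) :
  angle (a + k%:~R * (pi *+ 2)) = angle a.
Proof. by apply/esym/angleP; exists k; rewrite addrAC subrr add0r. Qed.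

Lemma angle_continuous (R : realType) : continuous (@angle R).
Proof. exact: pi_continuous. Qed.

(** The set of all lifts of the image of A is the union of the translates of A by
multiples of a full turn. *)
Lemma angle_open (R : realType) (A : set R) : open A -> open (@angle R @` A).
Proof.
move=> oA.
have -> : open (@angle R @` A) = open (@angle R @^-1` (@angle R @` A)) by [].
have -> : @angle R @^-1` (@angle R @` A) =
    \bigcup_(k : int) ((fun t => t + k%:~R * (pi *+ 2)) @^-1` A).
  apply/seteqP; split => x /=.
    move=> [y Ay /angleP[k kE]]; exists (- k) => //=.
    by rewrite rmorphN mulNr -kE opprB addrC subrK.
  by move=> [k _ /= Ak]; exists (x + k%:~R * (pi *+ 2)) => //; exact: angleDpi.
apply: bigcup_open => k _; apply: open_comp => // x _.
by apply: cvgD; [exact: cvg_id|exact: cvg_cst].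
Qed.

Lemma angle_inj_pi (R : realType) (a b : R) :
  a \in `]- pi, pi] -> `|b| < pi -> angle a = angle b -> a = b.
Proof.
rewrite in_itv/= ltr_norml => /andP[pa ap] /andP[pb bp] /angleP[k kE].
have p0 : 0 < pi :> R by exact: pi_gt0.
have [k0|k0|k0] := ltgtP k 0; last first.
- by move: kE; rewrite k0 mul0r => /eqP; rewrite subr_eq0 => /eqP.
- have : (1 : R) <= k%:~R by rewrite -[1]/(1%:~R) ler_int.
  move=> /(ler_wpM2r (ltW p0)); rewrite mulr2n mulrDr in kE; lra.
- have : k%:~R <= (- 1 : R) by rewrite -[- 1]/((-1)%:~R) ler_int -ltzD1.
  move=> /(ler_wpM2r (ltW p0)); rewrite mulr2n mulrDr in kE; lra.
Qed.

(** These boxes are a basis of neighborhoods of a state with alpha = 0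
([state_box_nbhs], [nbhs_state_box]), described through lifts of the angles. *)
Definition state_box (R : realType) (x0 y0 th0 r : R) : set (state R) :=
  [set z | exists x y th al : R,
    [/\ z = (x, y, angle th, angle al), `|x - x0| < r, `|y - y0| < r &
        `|th - th0| < r /\ `|al| < r]].

Lemma state_box_nbhs (R : realType) (x0 y0 th0 r : R) : 0 < r ->
  nbhs ((x0, y0, angle th0, angle 0) : state R) (state_box x0 y0 th0 r).
Proof.
move=> r0.
have nb (a : R) : nbhs (angle a) (@angle R @` ball a r).
  apply: open_nbhs_nbhs; split; first exact/angle_open/ball_open.
  by exists a => //; exact: ballxx.
exists (ball x0 r `*` ball y0 r `*` (@angle R @` ball th0 r), @angle R @` ball 0 r).
  split => /=; last exact: nb.
  exists (ball x0 r `*` ball y0 r, @angle R @` ball th0 r) => /=.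
    split; last exact: nb.
    by exists (ball x0 r, ball y0 r) => //=; split; exact: nbhsx_ballx.
  by move=> z [].
move=> [[[x y] _] _] /= [[[xr yr] [th thr <-]] [al alr <-]].
exists x, y, th, al; move: xr yr thr alr; rewrite -!ball_normE/=.
by rewrite sub0r normrN !(distrC _ x0) !(distrC _ y0) (distrC th0).
Qed.

Lemma nbhs_state_box (R : realType) (x0 y0 th0 : R) (W : set (state R)) :
  nbhs ((x0, y0, angle th0, angle 0) : state R) W ->
  exists2 r, 0 < r & state_box x0 y0 th0 r `<=` W.
Proof.
case=> -[A B] /= [[[A1 A2] /= [[[A11 A12] /= [nA11 nA12] sA1] nA2] sA] nB] sW.
have /nbhs_ballP[r1 /= r10 h1] := nA11.
have /nbhs_ballP[r2 /= r20 h2] := nA12.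
have /nbhs_ballP[r3 /= r30 h3] := @angle_continuous R th0 _ nA2.
have /nbhs_ballP[r4 /= r40 h4] := @angle_continuous R 0 _ nB.
exists (Num.min (Num.min r1 r2) (Num.min r3 r4)).
  by rewrite !lt_min r10 r20 r30 r40.
move=> _ [x [y [th [al [-> + + [+ +]]]]]]; rewrite !lt_min.
move=> /andP[/andP[xr _] _] /andP[/andP[_ yr] _] /andP[_ /andP[tr _]] /andP[_ /andP[_ ar]].
apply: sW; split => /=; last by apply: h4; rewrite -ball_normE/= sub0r normrN.
apply: sA; split => /=; last by apply: h3; rewrite -ball_normE/= distrC.
by apply: sA1; split => /=; [apply: h1|apply: h2]; rewrite -ball_normE/= distrC.
Qed.

(** * The equations of motion in scalar form *)

Section Equations.
Variables (R : realType) (P : swimmer R).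
Local Notation l1 := (ell1 P).
Local Notation l2 := (ell2 P).
Local Notation x1 := (xi1 P).
Local Notation x2 := (xi2 P).
Local Notation e1 := (eta1 P).
Local Notation e2 := (eta2 P).
Local Notation k := (kappa P).
Local Notation m1 := (M1 P).
Local Notation m2 := (M2 P).

(** The rows of E(alpha) applied to (u, w, om, nu): [forceX] and [forceY] are the
components of the total hydrodynamic force, [torque2] is the last row and
[torque1] the third row minus the last one, that is, the torques on each of the
two links about the joint. *)
Definition forceX (al u w om : R) : R :=
  - (x1 * l1 + x2 * l2) * cos al * u - (x1 * l1 + e2 * l2) * sin al * w
  + 1 / 2 * x1 * l1 * l2 * sin al * om.

Definition forceY (al u w om nu : R) : R :=
  (e1 * l1 + x2 * l2) * sin al * u - (e1 * l1 + e2 * l2) * cos al * w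
  + 1 / 2 * e1 * l1 * (l1 + l2 * cos al) * om + 1 / 2 * e1 * l1 ^+ 2 * nu.

Definition torque1 (al u w om nu : R) : R :=
  - (1 / 2) * e1 * l1 ^+ 2 * sin al * u + 1 / 2 * e1 * l1 ^+ 2 * cos al * w
  - e1 * l1 ^+ 2 * (1 / 4 * l2 * cos al + 1 / 3 * l1) * om
  - 1 / 3 * e1 * l1 ^+ 3 * nu.

Definition torque2 (w om : R) : R :=
  - (1 / 2) * e2 * l2 ^+ 2 * w - 1 / 12 * e2 * l2 ^+ 3 * om.

Lemma Emx_col4 (al u w om nu : R) :
  Emx P al *m col4 u w om nu =
  col4 (forceX al u w om) (forceY al u w om nu)
       (torque1 al u w om nu + torque2 w om) (torque2 w om).
Proof.
rewrite /forceX /forceY /torque1 /torque2.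
case: P => a1 a2 b1 b2 c1 c2 d n1 n2 /=.
apply/matrixP => i j; rewrite ord1 {j}.
by case: i => -[|[|[|[|//]]]] ?; rewrite !mxE !big_ord_recl big_ord0 !mxE /=; ring.
Qed.

Lemma rot_I2E (phi : R) :
  rot_I2 phi = mx_of_rows 4 4 [:: [:: cos phi; - sin phi; 0; 0];
    [:: sin phi; cos phi; 0; 0]; [:: 0; 0; 1; 0]; [:: 0; 0; 0; 1]].
Proof.
apply/matrixP => i j; rewrite !mxE; case: (splitP (i : 'I_(2 + 2))) => i' ->;
  rewrite !mxE; case: (splitP (j : 'I_(2 + 2))) => j' ->; rewrite !mxE;
  by case: i' => -[|[|//]] ?; case: j' => -[|[|//]] ?.
Qed.

Lemma rot_I2_col4 (phi a b c d : R) :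
  rot_I2 phi *m col4 a b c d =
  col4 (cos phi * a - sin phi * b) (sin phi * a + cos phi * b) c d.
Proof.
rewrite rot_I2E; apply/matrixP => i j; rewrite ord1 {j}.
by case: i => -[|[|[|[|//]]]] ?; rewrite !mxE !big_ord_recl big_ord0 !mxE /=; ring.
Qed.

Lemma col4_inj (a b c d a' b' c' d' : R) :
  col4 a b c d = col4 a' b' c' d' -> [/\ a = a', b = b', c = c' & d = d'].
Proof.
move=> E; have H (i : 'I_4) : col4 a b c d i 0 = col4 a' b' c' d' i 0 by rewrite E.
have := H (Ordinal (isT : (0 < 4)%N)); have := H (Ordinal (isT : (1 < 4)%N)).
have := H (Ordinal (isT : (2 < 4)%N)); have := H (Ordinal (isT : (3 < 4)%N)).
by rewrite !mxE /=.
Qed.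

Lemma rot_eq0 (phi a b : R) :
  cos phi * a - sin phi * b = 0 -> sin phi * a + cos phi * b = 0 ->
  a = 0 /\ b = 0.
Proof.
move=> h1 h2; have cs := cos2Dsin2 phi; split.
  transitivity ((cos phi ^+ 2 + sin phi ^+ 2) * a); first by rewrite cs mul1r.
  transitivity (cos phi * (cos phi * a - sin phi * b)
    + sin phi * (sin phi * a + cos phi * b)); first by ring.
  by rewrite h1 h2 !mulr0 addr0.
transitivity ((cos phi ^+ 2 + sin phi ^+ 2) * b); first by rewrite cs mul1r.
transitivity (cos phi * (sin phi * a + cos phi * b)
  - sin phi * (cos phi * a - sin phi * b)); first by ring.
by rewrite h1 h2 !mulr0 subr0.
Qed.

Definition swim_eq (Hpar Hperp al u w om nu : R) : Prop :=
  [/\ forceX al u w om = 0, forceY al u w om nu = 0,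
      torque1 al u w om nu = k * al - m1 * (cos al * Hperp - sin al * Hpar) &
      torque2 w om = - k * al - m2 * Hperp].

(** The outer rotation acts on a force that is zero, so it drops out; the inner one
turns the velocity into the frame of the second link. *)
Lemma Mh_eqP (th al xd yd om nu Hpar Hperp : R) :
  let u := cos th * xd + sin th * yd in
  let w := - sin th * xd + cos th * yd in
  Mh P th al *m col4 xd yd om nu = rhs P al Hpar Hperp <->
  swim_eq Hpar Hperp al u w om nu.
Proof.
move=> u w; rewrite /Mh -!mulmxA rot_I2_col4 cosN sinN.
have -> : cos th * xd - - sin th * yd = u by rewrite /u; ring.
rewrite -/w Emx_col4 rot_I2_col4 /rhs; split.
  move=> /col4_inj[fx fy t1 t2]; have [fx0 fy0] := rot_eq0 fx fy.
  by split => //; rewrite -?t2; lra.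
by move=> [-> -> -> ->]; rewrite !mulr0 subr0 addr0; congr col4; ring.
Qed.

End Equations.

(** * Uniqueness of solutions *)

Section NormBounds.
Variable R : realType.
Implicit Types x y a b D : R.

Lemma le_normD x y a b : `|x| <= a -> `|y| <= b -> `|x + y| <= a + b.
Proof. by move=> xa yb; apply: le_trans (ler_normD _ _) (lerD xa yb). Qed.

Lemma le_normN x a : `|x| <= a -> `|- x| <= a.
Proof. by rewrite normrN. Qed.

Lemma le_normM x y a b : `|x| <= a -> `|y| <= b -> `|x * y| <= a * b.
Proof. by move=> xa yb; rewrite normrM ler_pM. Qed.

Lemma le_norm_id x : `|x| <= `|x|. Proof. exact: lexx. Qed.

(** Bounds that keep track of a common factor D, for Lipschitz estimates. *)
Lemma le_normDM x y a b D :
  `|x| <= a * D -> `|y| <= b * D -> `|x + y| <= (a + b) * D.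
Proof. by rewrite mulrDl; exact: le_normD. Qed.

Lemma le_normMM x y a b D : `|x| <= a -> `|y| <= b * D -> `|x * y| <= (a * b) * D.
Proof. by rewrite -mulrA; exact: le_normM. Qed.

Lemma le_cos1 x : `|cos x| <= 1.
Proof. by rewrite ler_norml cos_geN1 cos_le1. Qed.

Lemma le_sin1 x : `|sin x| <= 1.
Proof. by rewrite ler_norml sin_geN1 sin_le1. Qed.

Lemma cos_lipschitz x y : `|cos x - cos y| <= 1 * `|x - y|.
Proof.
have h z : - (`|x| + `|y|) <= z <= `|x| + `|y| -> is_derive z 1 cos (- sin z).
  by move=> _; exact: is_derive_cos.
apply: (is_derive_lipschitz h) => [z _| |]; first by rewrite normrN le_sin1.
  by rewrite -ler_norml lerDr.
by rewrite -ler_norml lerDl.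
Qed.

Lemma sin_lipschitz x y : `|sin x - sin y| <= 1 * `|x - y|.
Proof.
have h z : - (`|x| + `|y|) <= z <= `|x| + `|y| -> is_derive z 1 sin (cos z).
  by move=> _; exact: is_derive_sin.
apply: (is_derive_lipschitz h) => [z _| |]; first by rewrite le_cos1.
  by rewrite -ler_norml lerDr.
by rewrite -ler_norml lerDl.
Qed.

End NormBounds.

(** Both tactics also work when the bound is an existential variable, which they
instantiate by following the structure of the expression. *)
Ltac norm_bound := repeat match goal with
  | |- is_true (`|_ + _| <= _) => eapply le_normD
  | |- is_true (`|- _| <= _) => eapply le_normN
  | |- is_true (`|_ * _| <= _) => eapply le_normM
  | |- is_true (`|cos _| <= _) => eapply le_cos1
  | |- is_true (`|sin _| <= _) => eapply le_sin1
  | |- _ => first [eassumption | eapply le_norm_id]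
  end.

Ltac norm_boundM := repeat match goal with
  | |- is_true (`|cos _ - cos _| <= _) => eapply cos_lipschitz
  | |- is_true (`|sin _ - sin _| <= _) => eapply sin_lipschitz
  | |- is_true (`|_ - _| <= _) => eassumption
  | |- is_true (`|_ + _| <= _) => eapply le_normDM
  | |- is_true (`|_ * _| <= _) => eapply le_normMM; [norm_bound|]
  end.

Section Uniqueness.
Variables (R : realType) (P : swimmer R).
Local Notation l1 := (ell1 P).
Local Notation l2 := (ell2 P).
Local Notation x1 := (xi1 P).
Local Notation x2 := (xi2 P).
Local Notation e1 := (eta1 P).
Local Notation e2 := (eta2 P).
Local Notation k := (kappa P).
Local Notation m1 := (M1 P).
Local Notation m2 := (M2 P).
Hypotheses (l1_gt0 : 0 < l1) (l2_gt0 : 0 < l2).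
Hypotheses (x1_gt0 : 0 < x1) (x2_gt0 : 0 < x2) (e1_gt0 : 0 < e1) (e2_gt0 : 0 < e2).

(** The power of the drag forces, computed globally on the left (force times
velocity of the joint, plus torques times angular velocities) and link by link on
the right. Here (u1, w1) is the velocity of the joint in the frame of the first
link. *)
Lemma power_balance (al u w om nu : R) :
  let u1 := cos al * u + sin al * (w - l2 / 2 * om) in
  let w1 := - sin al * u + cos al * (w - l2 / 2 * om) in
  let om1 := om + nu in
  - (forceX P al u w om * u1 + forceY P al u w om nu * w1
     + torque1 P al u w om nu * om1 + torque2 P w om * om)
  = x1 * l1 * u1 ^+ 2 + x2 * l2 * u ^+ 2
    + e1 * l1 * ((w1 - l1 / 2 * om1) ^+ 2 + l1 ^+ 2 / 12 * om1 ^+ 2)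
    + e2 * l2 * (w ^+ 2 + l2 ^+ 2 / 12 * om ^+ 2).
Proof.
rewrite /forceX /forceY /torque1 /torque2.
have := cos2Dsin2 al; move: (cos al) (sin al) => c s cs.
apply/eqP; rewrite -subr_eq0; apply/eqP.
(* Only the force on the second link changes frame, hence this remainder. *)
transitivity ((c ^+ 2 + s ^+ 2 - 1) *
  (x2 * l2 * u ^+ 2 + e2 * l2 * w * (w - l2 / 2 * om))); first by field.
by rewrite cs subrr mul0r.
Qed.

(** E(alpha) is invertible with an inverse bounded uniformly in alpha: by
[power_balance], a positive definite form of the velocities is at most the size
of the forces times the size of the velocities. *)
Lemma velocity_bound : exists2 C, 0 <= C & forall al u w om nu : R,
  `|u| + `|w| + `|om| + `|nu| <=
  C * (`|forceX P al u w om| + `|forceY P al u w om nu|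
       + `|torque1 P al u w om nu| + `|torque2 P w om|).
Proof.
have [l2h0 l2h] : 0 < l2 / 2 /\ l2 / 2 <= l2 by move: l2_gt0; split; lra.
pose c1 := x2 * l2; pose c2 := e2 * l2.
pose c3 := e2 * l2 * (l2 ^+ 2 / 12); pose c4 := e1 * l1 * (l1 ^+ 2 / 12).
have [c10 c20 c30 c40] : [/\ 0 < c1, 0 < c2, 0 < c3 & 0 < c4].
  by rewrite !mulr_gt0 ?invr_gt0 ?exprn_gt0.
pose c := Num.min (Num.min c1 c2) (Num.min c3 c4).
have c0 : 0 < c by rewrite !lt_min c10 c20 c30 c40.
have [cc1 cc2 cc3 cc4] : [/\ c <= c1, c <= c2, c <= c3 & c <= c4].
  by split; rewrite !ge_min lexx ?orbT.
exists (8 / c * (1 + l2)) => [|al u w om nu].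
  by apply: mulr_ge0; [apply: divr_ge0; rewrite ?ltW|apply: addr_ge0; rewrite ?ltW].
have := power_balance al u w om nu.
set u1 := (cos al * u + _); set w1 := (- sin al * u + _).
move: (forceX _ _ _ _ _) (forceY _ _ _ _ _ _) (torque1 _ _ _ _ _ _) (torque2 _ _ _).
move=> f1 f2 t1 t2 /= E.
set N := `|f1| + `|f2| + `|t1| + `|t2|.
(* The form controls the angular velocity om + nu of the first link. *)
pose S := `|u| + `|w| + `|om| + `|om + nu|.
have S0 : 0 <= S by rewrite /S !addr_ge0.
have qb : `|w - l2 / 2 * om| <= `|w| + l2 * `|om|.
  apply: le_trans (ler_normB _ _) _; rewrite lerD2l normrM ler_wpM2r//.
  by rewrite ger0_norm ?(ltW l2h0).
have [uS omS om1S] : [/\ `|u| + `|w| <= S, `|om| <= S & `|om + nu| <= S].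
  have := normr_ge0 u; have := normr_ge0 w; have := normr_ge0 om.
  by have := normr_ge0 (om + nu); rewrite /S; split; lra.
have l2S : 0 <= l2 * S by rewrite mulr_ge0// ltW.
have wS : `|u| + (`|w| + l2 * `|om|) <= (1 + l2) * S.
  by have := ler_wpM2l (ltW l2_gt0) omS; rewrite mulrDl mul1r; lra.
have u1b : `|u1| <= (1 + l2) * S.
  apply: le_trans (le_normD (le_normM (le_cos1 _) (le_norm_id _))
                            (le_normM (le_sin1 _) qb)) _.
  by rewrite !mul1r.
have w1b : `|w1| <= (1 + l2) * S.
  apply: le_trans (le_normD (le_normM (le_normN (le_sin1 _)) (le_norm_id _))
                            (le_normM (le_cos1 _) qb)) _.
  by rewrite !mul1r.
have omb : `|om| <= (1 + l2) * S by rewrite mulrDl mul1r; lra.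
have om1b : `|om + nu| <= (1 + l2) * S by rewrite mulrDl mul1r; lra.
have upper : - (f1 * u1 + f2 * w1 + t1 * (om + nu) + t2 * om) <= N * ((1 + l2) * S).
  move: ((1 + l2) * S) u1b w1b omb om1b => K u1b w1b omb om1b.
  apply: le_trans (ler_norm _) _; rewrite normrN /N !mulrDl.
  by do 3?[apply: le_normD]; rewrite normrM ler_wpM2l.
have lower : c * (u ^+ 2 + w ^+ 2 + om ^+ 2 + (om + nu) ^+ 2) <=
   - (f1 * u1 + f2 * w1 + t1 * (om + nu) + t2 * om).
  rewrite E.
  have -> : x1 * l1 * u1 ^+ 2 + x2 * l2 * u ^+ 2
    + e1 * l1 * ((w1 - l1 / 2 * (om + nu)) ^+ 2 + l1 ^+ 2 / 12 * (om + nu) ^+ 2)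
    + e2 * l2 * (w ^+ 2 + l2 ^+ 2 / 12 * om ^+ 2) =
    (x1 * l1 * u1 ^+ 2 + e1 * l1 * (w1 - l1 / 2 * (om + nu)) ^+ 2) +
    (c1 * u ^+ 2 + c2 * w ^+ 2 + c3 * om ^+ 2 + c4 * (om + nu) ^+ 2).
    by rewrite /c1 /c2 /c3 /c4; ring.
  rewrite -[leLHS]add0r !mulrDr; apply: lerD; last by rewrite !lerD// ler_wpM2r ?sqr_ge0.
  by apply: addr_ge0; apply: mulr_ge0; rewrite ?sqr_ge0//; apply: mulr_ge0; exact: ltW.
have SS : S ^+ 2 <= 4 * (u ^+ 2 + w ^+ 2 + om ^+ 2 + (om + nu) ^+ 2).
  rewrite /S -[u ^+ 2]real_normK ?num_real// -[w ^+ 2]real_normK ?num_real//.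
  rewrite -[om ^+ 2]real_normK ?num_real// -[(om + nu) ^+ 2]real_normK ?num_real//.
  move: (`|u|) (`|w|) (`|om|) (`|om + nu|) => a1 a2 a3 a4.
  have := sqr_ge0 (a1 - a2); have := sqr_ge0 (a1 - a3); have := sqr_ge0 (a1 - a4).
  have := sqr_ge0 (a2 - a3); have := sqr_ge0 (a2 - a4); have := sqr_ge0 (a3 - a4).
  by nra.
have SN : S <= 4 / c * (1 + l2) * N.
  have [->|S1] := eqVneq S 0.
    apply: mulr_ge0; last by rewrite /N !addr_ge0.
    by apply: mulr_ge0; [apply: divr_ge0; rewrite ?ltW|apply: addr_ge0; rewrite ?ltW].
  have S1' : 0 < S by rewrite lt_neqAle eq_sym S1.
  rewrite -(ler_pM2r S1') -(ler_pM2l c0).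
  have -> : c * (4 / c * (1 + l2) * N * S) = 4 * (N * ((1 + l2) * S)).
    by field; rewrite gt_eqF.
  have := le_trans lower upper; have := ler_wpM2l (ltW c0) SS.
  by rewrite expr2; lra.
have nub : `|nu| <= `|om| + `|om + nu|.
  have {1}-> : nu = - om + (om + nu) by ring.
  by apply: le_trans (ler_normD _ _) _; rewrite normrN.
have -> : 8 / c * (1 + l2) * N = 2 * (4 / c * (1 + l2) * N) by ring.
rewrite /S in SN *; have := normr_ge0 u; have := normr_ge0 w.
by have := normr_ge0 om; have := normr_ge0 (om + nu); lra.
Qed.

(** The difference of two velocities solves the equations at al with a right-hand
side that is O(|al - al'|), because the primed velocity is bounded; conclude with
[velocity_bound]. *)
Lemma velocity_lipschitz (B : R) : exists K : R,
  forall Hpar Hperp al u w om nu al' u' w' om' nu' : R,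
  swim_eq P Hpar Hperp al u w om nu -> swim_eq P Hpar Hperp al' u' w' om' nu' ->
  `|Hpar| <= B -> `|Hperp| <= B ->
  `|u'| <= B -> `|w'| <= B -> `|om'| <= B -> `|nu'| <= B ->
  `|u - u'| + `|w - w'| + `|om - om'| + `|nu - nu'| <= K * `|al - al'|.
Proof.
have [C C0 hC] := velocity_bound.
suff [K hK] : exists K : R, forall Hpar Hperp al u w om nu al' u' w' om' nu' : R,
  swim_eq P Hpar Hperp al u w om nu -> swim_eq P Hpar Hperp al' u' w' om' nu' ->
  `|Hpar| <= B -> `|Hperp| <= B ->
  `|u'| <= B -> `|w'| <= B -> `|om'| <= B -> `|nu'| <= B ->
  `|forceX P al (u - u') (w - w') (om - om')|
  + `|forceY P al (u - u') (w - w') (om - om') (nu - nu')|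
  + `|torque1 P al (u - u') (w - w') (om - om') (nu - nu')|
  + `|torque2 P (w - w') (om - om')| <= K * `|al - al'|.
  exists (C * K) => Hpar Hperp al u w om nu al' u' w' om' nu' E E' ? ? ? ? ? ?.
  apply: le_trans (hC _ _ _ _ _) _; rewrite -mulrA ler_wpM2l//.
  exact: hK E E' _ _ _ _ _ _.
eexists => Hpar Hperp al u w om nu al' u' w' om' nu' [X Y T1 T2] [X' Y' T1' T2'].
move=> hp ho hu hw hom hnu.
rewrite -[leLHS]ger0_norm ?addr_ge0//.
have -> : forceX P al (u - u') (w - w') (om - om') =
    (x1 * l1 + x2 * l2) * u' * (cos al - cos al')
    + (x1 * l1 + e2 * l2) * w' * (sin al - sin al')
    + (- (1 / 2 * x1 * l1 * l2)) * om' * (sin al - sin al').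
  transitivity (forceX P al u w om - forceX P al' u' w' om' -
    (forceX P al u' w' om' - forceX P al' u' w' om')).
    by rewrite /forceX; ring.
  by rewrite X {1}X' /forceX; ring.
have -> : forceY P al (u - u') (w - w') (om - om') (nu - nu') =
    (- (e1 * l1 + x2 * l2)) * u' * (sin al - sin al')
    + (e1 * l1 + e2 * l2) * w' * (cos al - cos al')
    + (- (1 / 2 * e1 * l1 * l2)) * om' * (cos al - cos al').
  transitivity (forceY P al u w om nu - forceY P al' u' w' om' nu' -
    (forceY P al u' w' om' nu' - forceY P al' u' w' om' nu')).
    by rewrite /forceY; ring.
  by rewrite Y {1}Y' /forceY; ring.
have -> : torque1 P al (u - u') (w - w') (om - om') (nu - nu') =
    k * (al - al') + (- (m1 * Hperp)) * (cos al - cos al')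
    + m1 * Hpar * (sin al - sin al')
    + 1 / 2 * e1 * l1 ^+ 2 * u' * (sin al - sin al')
    + (- (1 / 2 * e1 * l1 ^+ 2)) * w' * (cos al - cos al')
    + e1 * l1 ^+ 2 * (1 / 4 * l2) * om' * (cos al - cos al').
  transitivity (torque1 P al u w om nu - torque1 P al' u' w' om' nu' -
    (torque1 P al u' w' om' nu' - torque1 P al' u' w' om' nu')).
    by rewrite /torque1; ring.
  by rewrite T1 {1}T1' /torque1; ring.
have -> : torque2 P (w - w') (om - om') = (- k) * (al - al').
  transitivity (torque2 P w om - torque2 P w' om'); first by rewrite /torque2; ring.
  by rewrite T2 T2'; ring.
have al1 : `|al - al'| <= 1 * `|al - al'| by rewrite mul1r.
by repeat eapply le_normDM; rewrite normr_id; norm_boundM.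
Qed.

End Uniqueness.

Section SolutionUniqueness.
Variables (R : realType) (P : swimmer R).
Hypotheses (l1_gt0 : 0 < ell1 P) (l2_gt0 : 0 < ell2 P).
Hypotheses (x1_gt0 : 0 < xi1 P) (x2_gt0 : 0 < xi2 P).
Hypotheses (e1_gt0 : 0 < eta1 P) (e2_gt0 : 0 < eta2 P).

(** By [velocity_lipschitz] and Gronwall's lemma the two angles alpha agree; then
the velocities agree almost everywhere, and theta, x and y follow. *)
Lemma satisfies_S_unique (T B : R) (Hpar Hperp x y th al x' y' th' al' : R -> R) :
  [/\ abs_continuous 0 T x, abs_continuous 0 T y,
      abs_continuous 0 T th & abs_continuous 0 T al] ->
  [/\ abs_continuous 0 T x', abs_continuous 0 T y',
      abs_continuous 0 T th' & abs_continuous 0 T al'] ->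
  satisfies_S P T Hpar Hperp x y th al ->
  satisfies_S P T Hpar Hperp x' y' th' al' ->
  {ae @lebesgue_measure R, forall t, t \in `]0, T[ ->
    [/\ `|Hpar t| <= B, `|Hperp t| <= B, `|derive1 x' t| <= B & `|derive1 y' t| <= B]
    /\ (`|derive1 th' t| <= B /\ `|derive1 al' t| <= B)} ->
  [/\ x 0 = x' 0, y 0 = y' 0, th 0 = th' 0 & al 0 = al' 0] ->
  forall t, 0 <= t <= T -> [/\ x t = x' t, y t = y' t, th t = th' t & al t = al' t].
Proof.
move=> [acx acy acth acal] [acx' acy' acth' acal'] S S' bd [x0 y0 th0 al0].
have [K hK] := velocity_lipschitz l1_gt0 l2_gt0 x1_gt0 x2_gt0 e1_gt0 e2_gt0 (B + B).
have key : {ae @lebesgue_measure R, forall t, t \in `]0, T[ ->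
    [/\ derivable x t 1, derivable y t 1, derivable th t 1 & derivable al t 1] /\
    [/\ derivable x' t 1, derivable y' t 1, derivable th' t 1 & derivable al' t 1] /\
    `|(cos (th t) * derive1 x t + sin (th t) * derive1 y t)
      - (cos (th' t) * derive1 x' t + sin (th' t) * derive1 y' t)|
    + `|(- sin (th t) * derive1 x t + cos (th t) * derive1 y t)
      - (- sin (th' t) * derive1 x' t + cos (th' t) * derive1 y' t)|
    + `|derive1 th t - derive1 th' t| + `|derive1 al t - derive1 al' t|
    <= K * `|al t - al' t|}.
  apply: (ae_impl (ae_and (ae_and S S') bd)) => t /= [[St S't] bdt] tT.
  have [dx dy dth dal /Mh_eqP E] := St tT.
  have [dx' dy' dth' dal' /Mh_eqP E'] := S't tT.
  have [[hp ho bx by_] [bth bal]] := bdt tT.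
  have B0 : 0 <= B by exact: le_trans hp.
  have BB : B <= B + B by rewrite lerDl.
  split=> //; split=> //; apply: hK E E' _ _ _ _ _ _; try exact: le_trans BB.
    rewrite -[B]mul1r; apply: le_normD; apply: le_normM => //.
      exact: le_cos1.
    exact: le_sin1.
  rewrite -[B]mul1r; apply: le_normD; apply: le_normM => //.
    exact/le_normN/le_sin1.
  exact: le_cos1.
have alE t : 0 <= t <= T -> al t = al' t.
  move=> tT; apply/eqP; rewrite -subr_eq0; apply/eqP.
  apply: (@abs_continuous_gronwall0 _ 0 T K (fun t => al t + - al' t)) tT.
  - by apply: abs_continuousD => //; exact: abs_continuousN.
  - by rewrite al0 subrr.
  apply: (ae_impl key) => {}t + tT => /(_ tT)[[_ _ _ dal] [[_ _ _ dal'] h]].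
  have /derivableP D := dal; have /derivableP D' := dal'.
  have DD := is_deriveDr D (is_deriveNr D').
  split; first by case: DD.
  rewrite derive1E derive_val -!derive1E; apply: le_trans h.
  by rewrite lerDr !addr_ge0.
have key' : {ae @lebesgue_measure R, forall t, t \in `]0, T[ ->
    [/\ derivable x t 1, derivable y t 1 & derivable th t 1] /\
    [/\ derivable x' t 1, derivable y' t 1 & derivable th' t 1] /\
    [/\ (cos (th t) * derive1 x t + sin (th t) * derive1 y t)
      = (cos (th' t) * derive1 x' t + sin (th' t) * derive1 y' t),
     (- sin (th t) * derive1 x t + cos (th t) * derive1 y t)
      = (- sin (th' t) * derive1 x' t + cos (th' t) * derive1 y' t) &
     derive1 th t = derive1 th' t]}.
  apply: (ae_impl key) => t + tT => /(_ tT)[[dx dy dth _] [[dx' dy' dth' _]]].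
  rewrite alE; last by move: tT; rewrite in_itv/= => /andP[/ltW -> /ltW ->].
  rewrite subrr normr0 mulr0 -subr_ge0 sub0r oppr_ge0.
  set a1 := `|_ - _|; set a2 := `|_ - _|; set a3 := `|_ - _|; set a4 := `|_ - _| => h.
  have [? ? ? ?] : [/\ 0 <= a1, 0 <= a2, 0 <= a3 & 0 <= a4].
    by split; exact: normr_ge0.
  split=> //; split=> //; split.
  - by apply/eqP; rewrite -subr_eq0 -normr_eq0 eq_le normr_ge0 andbT -/a1; lra.
  - by apply/eqP; rewrite -subr_eq0 -normr_eq0 eq_le normr_ge0 andbT -/a2; lra.
  - by apply/eqP; rewrite -subr_eq0 -normr_eq0 eq_le normr_ge0 andbT -/a3; lra.
have thE t : 0 <= t <= T -> th t = th' t.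
  move=> /(abs_continuous_eq_derive acth acth').
  rewrite th0 => /(_ _)/addIr; apply.
  by apply: (ae_impl key') => s + sT => /(_ sT)[[_ _ ?] [[_ _ ?] [_ _ ?]]].
have xyE : {ae @lebesgue_measure R, forall t, t \in `]0, T[ ->
   [/\ derivable x t 1, derivable x' t 1 & derive1 x t = derive1 x' t] /\
   [/\ derivable y t 1, derivable y' t 1 & derive1 y t = derive1 y' t]}.
  apply: (ae_impl key') => t + tT => /(_ tT)[[dx dy _] [[dx' dy' _] []]].
  rewrite thE; last by move: tT; rewrite in_itv/= => /andP[/ltW -> /ltW ->].
  move=> h1 h2 _.
  have := @rot_eq0 R (- th' t) (derive1 x t - derive1 x' t) (derive1 y t - derive1 y' t).
  rewrite cosN sinN => -[||/eqP + /eqP]; [lra|lra|].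
  by rewrite !subr_eq0 => /eqP ? /eqP ?; split; split.
move=> t tT; split; [| |exact: thE|exact: alE].
- move: (tT) => /(abs_continuous_eq_derive acx acx').
  rewrite x0 => /(_ _)/addIr; apply.
  by apply: (ae_impl xyE) => s + sT => /(_ sT)[].
- move: (tT) => /(abs_continuous_eq_derive acy acy').
  rewrite y0 => /(_ _)/addIr; apply.
  by apply: (ae_impl xyE) => s + sT => /(_ sT)[].
Qed.

End SolutionUniqueness.

(** * Body velocities, the torque balance and the pivot *)

Lemma is_derive_continuous (R : realType) (f df : R -> R) :
  (forall t : R, is_derive t 1 f (df t)) -> continuous f.
Proof.
move=> h t; apply/differentiable_continuous/derivable1_diffP.
by case: (h t).
Qed.

(** The primitive is integrated from -1, which is why it is only claimed to be one
on ]-1, 1[. *)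
Lemma continuous_antiderivative (R : realType) (f : R -> R) : continuous f ->
  exists2 F : R -> R, F 0 = 0 & forall t : R, `|t| < 1 -> is_derive t 1 F (f t).
Proof.
move=> cf.
pose G (t : R) : R := (\int[lebesgue_measure]_(s in [set` `[(- 1)%R, t]]) f s)%R.
exists (fun t => G t + - G 0) => [|t]; first by rewrite subrr.
rewrite ltr_norml => /andP[t1 t2].
have fi : lebesgue_measure.-integrable `[(- 1)%R, 1] (EFin \o f).
  apply: continuous_compact_integrable; first exact: segment_compact.
  exact: continuous_subspaceT.
have [dG GE] := continuous_FTC1_closed t2 fi t1 (cf t).
have D : is_derive t 1 G (f t) by rewrite -GE derive1E; exact/derivableP.
by eapply is_derive_subst; [derivation|rewrite /= addr0].
Qed.

Section Fields.
Variables (R : realType) (P : swimmer R).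
Local Notation l1 := (ell1 P).
Local Notation l2 := (ell2 P).
Local Notation x1 := (xi1 P).
Local Notation x2 := (xi2 P).
Local Notation e1 := (eta1 P).
Local Notation e2 := (eta2 P).
Local Notation k := (kappa P).
Local Notation m1 := (M1 P).
Local Notation m2 := (M2 P).
Hypotheses (l1_gt0 : 0 < l1) (l2_gt0 : 0 < l2).
Hypotheses (x1_gt0 : 0 < x1) (x2_gt0 : 0 < x2) (e1_gt0 : 0 < e1) (e2_gt0 : 0 < e2).

Local Notation dxx := (x1 * l1 + x2 * l2).
Local Notation dxe := (x1 * l1 + e2 * l2).
Local Notation dex := (e1 * l1 + x2 * l2).
Local Notation dee := (e1 * l1 + e2 * l2).

(** The determinant of the equations [forceX] = [forceY] = 0 in the unknowns u, w;
[bodyU] and [bodyW] are their solution by Cramer's rule. *)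
Definition drag_det (al : R) : R :=
  dxx * dee * (cos al * cos al) + dxe * dex * (sin al * sin al).

Definition bodyU (om nu al : R) : R :=
  (1 / 2 * x1 * l1 * l2 * sin al * om * dee * cos al
   - dxe * sin al * (1 / 2 * e1 * l1 * (l1 + l2 * cos al) * om + 1 / 2 * e1 * l1 ^+ 2 * nu))
  * (drag_det al)^-1.

Definition bodyW (om nu al : R) : R :=
  (dxx * cos al * (1 / 2 * e1 * l1 * (l1 + l2 * cos al) * om + 1 / 2 * e1 * l1 ^+ 2 * nu)
   + dex * sin al * (1 / 2 * x1 * l1 * l2 * sin al * om))
  * (drag_det al)^-1.

Lemma drag_sums_gt0 : [/\ 0 < dxx, 0 < dxe, 0 < dex & 0 < dee].
Proof. by split; rewrite addr_gt0// mulr_gt0. Qed.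

Lemma drag_det_ge (al : R) : Num.min (dxx * dee) (dxe * dex) <= drag_det al.
Proof.
set m := Num.min _ _; rewrite /drag_det -!expr2.
rewrite -[m]mulr1 -(cos2Dsin2 al) mulrDr.
by rewrite lerD// ler_wpM2r ?sqr_ge0// ge_min lexx ?orbT.
Qed.

Lemma drag_det_min_gt0 : 0 < Num.min (dxx * dee) (dxe * dex).
Proof. by have [? ? ? ?] := drag_sums_gt0; rewrite lt_min !mulr_gt0. Qed.

Lemma drag_det_neq0 (al : R) : drag_det al != 0.
Proof. by rewrite gt_eqF// (lt_le_trans drag_det_min_gt0)// drag_det_ge. Qed.

Lemma forceX_body (om nu al : R) :
  forceX P al (bodyU om nu al) (bodyW om nu al) om = 0.
Proof.
rewrite /forceX /bodyU /bodyW; have := drag_det_neq0 al.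
by rewrite /drag_det => ?; field.
Qed.

Lemma forceY_body (om nu al : R) :
  forceY P al (bodyU om nu al) (bodyW om nu al) om nu = 0.
Proof.
rewrite /forceY /bodyU /bodyW; have := drag_det_neq0 al.
by rewrite /drag_det => ?; field.
Qed.

Lemma body_bounded (om nu : R) : exists C, forall al,
  `|bodyU om nu al| <= C /\ `|bodyW om nu al| <= C.
Proof.
have inv al : `|(drag_det al)^-1| <= (Num.min (dxx * dee) (dxe * dex))^-1.
  have h := drag_det_min_gt0.
  have h' : 0 < drag_det al by apply: lt_le_trans h (drag_det_ge al).
  by rewrite ger0_norm ?invr_ge0 ?(ltW h')// lef_pV2 ?posrE// drag_det_ge.
have [C hC] : exists C, forall al, `|bodyU om nu al| <= C.
  by eexists => al; have := inv al; rewrite /bodyU => ?; norm_bound.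
have [C' hC'] : exists C, forall al, `|bodyW om nu al| <= C.
  by eexists => al; have := inv al; rewrite /bodyW => ?; norm_bound.
have C0 := le_trans (normr_ge0 _) (hC 0).
have C'0 := le_trans (normr_ge0 _) (hC' 0).
exists (C + C') => al; split.
  by apply: le_trans (hC al) _; rewrite lerDl.
by apply: le_trans (hC' al) _; rewrite lerDr.
Qed.

Lemma bodyU_linear (a b om nu om' nu' al : R) :
  bodyU (a * om + b * om') (a * nu + b * nu') al =
  a * bodyU om nu al + b * bodyU om' nu' al.
Proof. by rewrite /bodyU; ring. Qed.

Lemma bodyW_linear (a b om nu om' nu' al : R) :
  bodyW (a * om + b * om') (a * nu + b * nu') al =
  a * bodyW om nu al + b * bodyW om' nu' al.
Proof. by rewrite /bodyW; ring. Qed.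

Lemma is_derive_drag_det (al : R) : is_derive al 1 drag_det
  (2 * (dxe * dex - dxx * dee) * sin al * cos al).
Proof. by eapply is_derive_subst; [rewrite /drag_det; derivation|move=> /=; ring]. Qed.

Lemma is_derive_bodyU (om nu al : R) : exists d, is_derive al 1 (bodyU om nu) d.
Proof.
have dd := is_deriveVr (drag_det_neq0 al) (is_derive_drag_det al).
by eexists; rewrite /bodyU; derivation.
Qed.

Lemma is_derive_bodyW (om nu al : R) : exists d, is_derive al 1 (bodyW om nu) d.
Proof.
have dd := is_deriveVr (drag_det_neq0 al) (is_derive_drag_det al).
by eexists; rewrite /bodyW; derivation.
Qed.

(** What is left of the torque on the first link after the transverse field has
been eliminated with the torque on the second one. *)
Definition torque_balance (om nu al : R) : R :=
  torque1 P al (bodyU om nu al) (bodyW om nu al) om nu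
  - m1 / m2 * cos al * torque2 P (bodyW om nu al) om.

(** The ratio om / nu for which the balance vanishes at alpha = 0. *)
Definition gait_slope : R := - torque_balance 0 1 0 / torque_balance 1 0 0.

Lemma torque_balance_linear (a b om nu om' nu' al : R) :
  torque_balance (a * om + b * om') (a * nu + b * nu') al =
  a * torque_balance om nu al + b * torque_balance om' nu' al.
Proof.
rewrite /torque_balance bodyU_linear bodyW_linear /torque1 /torque2; ring.
Qed.

(** This is where the nondegeneracy condition on the magnetizations appears. *)
Lemma torque_balance_rotation0 : m2 != 0 ->
  torque_balance 1 0 0 = e1 * l1 ^+ 2 * e2 * l2 ^+ 2 / (12 * dee * m2) *
   ((3 + 4 * (l2 / l1) + (e2 * l2 ^+ 2) / (e1 * l1 ^+ 2)) * m1
    - (3 + 4 * (l1 / l2) + (e1 * l1 ^+ 2) / (e2 * l2 ^+ 2)) * m2).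
Proof.
move=> m20; rewrite /torque_balance /bodyU /bodyW /torque1 /torque2 /drag_det.
rewrite sin0 cos0; have [? ? ? ?] := drag_sums_gt0.
by field; rewrite m20 !gt_eqF.
Qed.

Hypotheses (m1_neq0 : m1 != 0) (m2_neq0 : m2 != 0).
Hypothesis nondeg : torque_balance 1 0 0 != 0.
Local Notation c := gait_slope.

Lemma torque_balance_gait0 : torque_balance c 1 0 = 0.
Proof.
have := torque_balance_linear c 1 1 0 0 1 0.
rewrite !mul1r !mulr0 !mulr1 addr0 add0r => ->.
by rewrite /gait_slope; field.
Qed.

Lemma torque_balance_bounded (om nu : R) :
  exists C, forall al, `|torque_balance om nu al| <= C.
Proof.
have [C hC] := body_bounded om nu.
eexists => al; have [hU hW] := hC al.
by rewrite /torque_balance /torque1 /torque2; norm_bound.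
Qed.

Lemma is_derive_torque_balance (om nu al : R) :
  exists d, is_derive al 1 (torque_balance om nu) d.
Proof.
have [dU hU] := is_derive_bodyU om nu al.
have [dW hW] := is_derive_bodyW om nu al.
by eexists; rewrite /torque_balance /torque1 /torque2; derivation.
Qed.

(** The balance along the gait vanishes at alpha = 0 and is differentiable there,
so it is O(alpha), that is, O(sin alpha). *)
Lemma near_straight (eta : R) : 0 < eta ->
  exists r C : R, [/\ 0 < r, r < 1 & forall al, `|al| <= r ->
    [/\ `|al| <= 2 * `|sin al|, `|torque_balance c 1 al| <= C * `|sin al| &
        `|cos al - 1| <= eta]].
Proof.
move=> eta0.
have [r1 r10 h1] := is_derive_near (is_derive_sin (0 : R)) (ltac:(lra) : 0 < 2^-1 :> R).
have [d hd] := is_derive_torque_balance c 1 0.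
have [r2 r20 h2] := is_derive_near hd ltr01.
pose r := Num.min (Num.min r1 r2) (Num.min eta 1).
have r0 : 0 < r by rewrite !lt_min r10 r20 eta0 ltr01.
have rle1 : r <= 1 by rewrite !ge_min lexx !orbT.
have half : r / 2 < r by lra.
exists (r / 2), ((`|d| + 1) * 2); split; first by lra.
  by lra.
move=> al alr; have alr' : `|al| < r by exact: le_lt_trans half.
have [a1 a2 a3] : [/\ `|al| < r1, `|al| < r2 & `|al| < eta].
  by move: alr'; rewrite !lt_min => /andP[/andP[-> ->] /andP[->]].
have salE : `|al| <= 2 * `|sin al|.
  have := h1 al; rewrite subr0 sin0 cos0 mul1r subr0 => /(_ a1).
  have := ler_normB (al - sin al) (- sin al).
  have -> : al - sin al - - sin al = al by ring.
  by rewrite normrN distrC; lra.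
split => //.
- have := h2 al; rewrite subr0 torque_balance_gait0 subr0 => /(_ a2) h.
  have -> : torque_balance c 1 al =
    (torque_balance c 1 al - d * al) + d * al by ring.
  apply: le_trans (ler_normD _ _) _; rewrite normrM -mulrA.
  have := ler_wpM2l (addr_ge0 (normr_ge0 d) ler01) salE; lra.
- have := cos_lipschitz al 0; rewrite cos0 mul1r subr0; lra.
Qed.

(** The velocity of the swimmer when alpha moves at unit speed along the gait, in
the frame in which theta = c alpha. *)
Definition shapeX' (al : R) : R :=
  cos (c * al) * bodyU c 1 al - sin (c * al) * bodyW c 1 al.
Definition shapeY' (al : R) : R :=
  sin (c * al) * bodyU c 1 al + cos (c * al) * bodyW c 1 al.

Lemma shape_path : exists X Y : R -> R,
  [/\ X 0 = 0, Y 0 = 0 & forall al : R, `|al| < 1 ->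
    is_derive al 1 X (shapeX' al) /\ is_derive al 1 Y (shapeY' al)].
Proof.
have cU : continuous (bodyU c 1).
  have /choice[d hd] : forall al : R, exists d : R, is_derive al 1 (bodyU c 1) d.
    exact: is_derive_bodyU.
  exact: is_derive_continuous hd.
have cW : continuous (bodyW c 1).
  have /choice[d hd] : forall al : R, exists d : R, is_derive al 1 (bodyW c 1) d.
    exact: is_derive_bodyW.
  exact: is_derive_continuous hd.
have lin : continuous (fun al : R => c * al).
  by apply: (@is_derive_continuous R _ (fun=> c)) => al;
     eapply is_derive_subst; [derivation|move=> /=; ring].
have cc : continuous (fun al : R => cos (c * al)).
  by move=> al; apply: continuous_comp; [exact: lin|exact: continuous_cos].
have cs : continuous (fun al : R => sin (c * al)).
  by move=> al; apply: continuous_comp; [exact: lin|exact: continuous_sin].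
have [|X X0 hX] := @continuous_antiderivative R shapeX'.
  move=> al; apply: cvgB; apply: cvgM;
  [exact: cc|exact: cU|exact: cs|exact: cW].
have [|Y Y0 hY] := @continuous_antiderivative R shapeY'.
  move=> al; apply: cvgD; apply: cvgM;
  [exact: cs|exact: cU|exact: cc|exact: cW].
by exists X, Y; split => // al al1; split; [exact: hX|exact: hY].
Qed.

(** The function below is the second coordinate of the pivot, [pivotY] further
down. Its derivative, the curvature at the straight shape of the connection that
turns changes of shape into displacements, is nonzero as soon as one link has
eta > xi and none has eta < xi. *)
Lemma is_derive_pivotY (Y : R -> R) : is_derive (0 : R) 1 Y (shapeY' 0) ->
  is_derive (0 : R) 1
    (fun al : R => Y al - sin (c * al) * bodyW 1 0 al + cos (c * al) * bodyU 1 0 al)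
    (- (l1 * l2 / (2 * dxx * dee)
      * (e2 * l2 * (e1 - x1) + e1 * l1 * (e2 - x2)))).
Proof.
move=> dY.
have dd := is_deriveVr (drag_det_neq0 0) (is_derive_drag_det 0).
have [? ? ? ?] := drag_sums_gt0.
eapply is_derive_subst; first by rewrite /bodyU /bodyW; derivation.
rewrite /= /shapeY' /bodyU /bodyW /drag_det !mulr0 sin0 cos0.
by field; rewrite !gt_eqF.
Qed.

End Fields.

(** * Motions along the gait *)

Definition lipschitz_itv (R : realType) (K a b : R) (f : R -> R) : Prop :=
  forall s t, a <= s <= b -> a <= t <= b -> `|f t - f s| <= K * `|t - s|.

Definition glue (R : realType) (T : Type) (b : R) (f g : R -> T) (t : R) : T :=
  if t < b then f t else g t.

Section Glue.
Variable R : realType.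
Implicit Types (f g : R -> R) (a b c t K : R).

Lemma lipschitz_glue K a b c f g : a <= b -> b <= c -> f b = g b ->
  lipschitz_itv K a b f -> lipschitz_itv K b c g ->
  lipschitz_itv K a c (glue b f g).
Proof.
move=> ab bc fg lf lg s t; wlog st : s t / s <= t.
  move=> W sac tac; have [st|/ltW ts] := leP s t; first exact: W.
  by rewrite distrC (distrC t); exact: W.
move=> /andP[as_ sc] /andP[at_ tc]; rewrite /glue.
have [tb|bt] := ltP t b.
  rewrite (le_lt_trans st tb); apply: lf.
    by rewrite as_ (le_trans st (ltW tb)).
  by rewrite at_ ltW.
have [sb|bs] := ltP s b; last by apply: lg; rewrite ?bs ?bt.
have h1 : `|f b - f s| <= K * `|b - s| by apply: lf; rewrite ?as_ ?ab ?lexx ?ltW.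
have h2 : `|g t - g b| <= K * `|t - b| by apply: lg; rewrite ?lexx ?bc ?bt.
have -> : g t - f s = (g t - g b) + (f b - f s) by rewrite fg; ring.
apply: le_trans (le_normD h2 h1) _; rewrite -mulrDr.
by rewrite !ger0_norm ?subr_ge0 ?(ltW sb)// addrA subrK.
Qed.

Lemma is_derive_glue_lt b f g t d : t < b ->
  is_derive t 1 f d -> is_derive t 1 (glue b f g) d.
Proof.
move=> tb; apply: near_eq_is_derive; near=> s; rewrite /glue ifT//.
by near: s; exact: lt_nbhsl.
Unshelve. all: by end_near. Qed.

Lemma is_derive_glue_gt b f g t d : b < t ->
  is_derive t 1 g d -> is_derive t 1 (glue b f g) d.
Proof.
move=> bt; apply: near_eq_is_derive; near=> s; rewrite /glue ifF//.
by apply/negbTE; rewrite -leNgt; apply/ltW; near: s; exact: lt_nbhsr.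
Unshelve. all: by end_near. Qed.

Lemma measurable_glue b f g : measurable_fun setT f -> measurable_fun setT g ->
  measurable_fun setT (glue b f g).
Proof.
move=> mf mg; apply: measurable_fun_ifT => //.
by apply: measurable_fun_ltr.
Qed.

End Glue.

Section Motions.
Variables (R : realType) (P : swimmer R).
Local Notation c := (gait_slope P).
Local Notation U := (bodyU P).
Local Notation W := (bodyW P).
Local Notation pose4 := (R * R * R * R)%type.

(** The kinematics at time t for the inputs v and p: the angles are driven, and the
position follows from the vanishing of the total force. *)
Definition driven (x y th al v p : R -> R) (t : R) : Prop :=
  let om := c * v t + sin (al t) * p t in
  let u := U om (v t) (al t) in
  let w := W om (v t) (al t) in
  [/\ is_derive t 1 x (cos (th t) * u - sin (th t) * w),
      is_derive t 1 y (sin (th t) * u + cos (th t) * w),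
      is_derive t 1 th om & is_derive t 1 al (v t)].

(** The exceptional set is finite, because motions are glued from finitely many
smooth pieces. The inputs and alpha are measurable on the whole line so that
gluing preserves measurability. The Lipschitz constant bounds how far the
swimmer strays. *)
Definition motion_along (rho K t0 t1 : R) (x y th al v p : R -> R) : Prop :=
  [/\ [/\ lipschitz_itv K t0 t1 x, lipschitz_itv K t0 t1 y,
         lipschitz_itv K t0 t1 th & lipschitz_itv K t0 t1 al],
      [/\ measurable_fun setT al, measurable_fun setT v & measurable_fun setT p],
      forall t, `|v t| <= rho /\ `|p t| <= rho &
      exists s : seq R, forall t, t0 < t < t1 -> t \notin s ->
        driven x y th al v p t].

Definition motion (rho K t0 t1 : R) (q q' : pose4) : Prop :=
  exists x y th al v p : R -> R,
    [/\ motion_along rho K t0 t1 x y th al v p,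
        (x t0, y t0, th t0, al t0) = q & (x t1, y t1, th t1, al t1) = q'].

Lemma motion_trans rho K t0 t1 t2 q q' q'' : t0 <= t1 -> t1 <= t2 ->
  motion rho K t0 t1 q q' -> motion rho K t1 t2 q' q'' ->
  motion rho K t0 t2 q q''.
Proof.
move=> t01 t12.
move=> [x [y [th [al [v [p [[[Lx Ly Lt La] [Ma Mv Mp] B [s S]] Q Q']]]]]]].
move=> [x' [y' [th' [al' [v' [p' [[[Lx' Ly' Lt' La'] [Ma' Mv' Mp'] B' [s' S']] Q1 Q1']]]]]]].
move: (Q1) => + ; rewrite -Q' => -[ex ey eth eal].
exists (glue t1 x x'), (glue t1 y y'), (glue t1 th th'), (glue t1 al al'),
  (glue t1 v v'), (glue t1 p p').
have gE (f g : R -> R) : f t1 = g t1 -> glue t1 f g t0 = f t0.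
  by move=> fg; rewrite /glue; case: ltP => // h; have -> : t0 = t1 by apply/le_anti/andP.
split; last 2 first.
- by rewrite !gE.
- by rewrite /glue ltNge t12.
split.
- by split; exact: lipschitz_glue.
- by split; exact: measurable_glue.
- by move=> t; rewrite /glue; case: ifP.
exists (t1 :: s ++ s') => t /andP[t0t tt2].
rewrite inE mem_cat !negb_or => /andP[tt1 /andP[ts ts']].
have [lt|gt|eq] := ltgtP t t1; last by rewrite eq eqxx in tt1.
  have [||dx dy dth dal] := S t; rewrite ?t0t//.
  rewrite /driven; have gl (f g : R -> R) : glue t1 f g t = f t by rewrite /glue lt.
  by rewrite !gl; split; exact: is_derive_glue_lt.
have [||dx dy dth dal] := S' t; rewrite ?gt//.
rewrite /driven; have gl (f g : R -> R) : glue t1 f g t = g t.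
  by rewrite /glue ltNge (ltW gt).
by rewrite !gl; split; exact: is_derive_glue_gt.
Qed.

Hypotheses (l1_gt0 : 0 < ell1 P) (l2_gt0 : 0 < ell2 P).
Hypotheses (x1_gt0 : 0 < xi1 P) (x2_gt0 : 0 < xi2 P).
Hypotheses (e1_gt0 : 0 < eta1 P) (e2_gt0 : 0 < eta2 P).
Variables (X Y : R -> R).
Hypothesis shapeXY : forall al : R, `|al| < 1 ->
  is_derive al 1 X (shapeX' P al) /\ is_derive al 1 Y (shapeY' P al).
Variables (B rho : R).
Hypothesis (rho_ge0 : 0 <= rho).
Hypothesis bodyB : forall al, [/\ `|U c 1 al| <= B, `|W c 1 al| <= B,
  `|U 1 0 al| <= B & `|W 1 0 al| <= B].
(** The same bound B of the body velocities and the same K serve for both kinds of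
elementary motions. *)
Let K := (2 * B + `|c| + 1) * rho.

Lemma body_scale (a om nu al : R) :
  U (a * om) (a * nu) al = a * U om nu al /\
  W (a * om) (a * nu) al = a * W om nu al.
Proof. by rewrite /bodyU /bodyW; split; ring. Qed.

Let B_ge0 : 0 <= B.
Proof. by have [h _ _ _] := bodyB 0; exact: le_trans h. Qed.

Let K_ge (z : R) : z <= 2 * B + `|c| + 1 -> z * rho <= K.
Proof. by move=> ?; rewrite /K ler_wpM2r. Qed.

Let planar_bound (phi a b v : R) : `|a| <= B -> `|b| <= B -> `|v| <= rho ->
  `|(cos phi * a - sin phi * b) * v| <= K /\
  `|(sin phi * a + cos phi * b) * v| <= K.
Proof.
move=> aB bB vr.
have h : (B + B) * rho <= K.
  by apply: K_ge; have := normr_ge0 c; lra.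
split; apply: le_trans h; apply: le_normM => //; apply: le_normD; rewrite ?normrN.
- by rewrite -[B]mul1r; apply: le_normM => //; exact: le_cos1.
- by rewrite -[B]mul1r; apply: le_normM => //; exact: le_sin1.
- by rewrite -[B]mul1r; apply: le_normM => //; exact: le_sin1.
- by rewrite -[B]mul1r; apply: le_normM => //; exact: le_cos1.
Qed.

(** With p = 0 the quantity phi = theta - c alpha is constant, and the position moves
by the rotation of angle phi applied to an increment of (X, Y). *)
Lemma motion_shape (t0 t1 x y phi a0 a1 : R) : t0 < t1 ->
  `|a0| < 1 -> `|a1| < 1 -> `|a1 - a0| <= rho * (t1 - t0) ->
  motion rho K t0 t1 (x, y, phi + c * a0, a0)
    (x + (cos phi * (X a1 - X a0) - sin phi * (Y a1 - Y a0)),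
     y + (sin phi * (X a1 - X a0) + cos phi * (Y a1 - Y a0)), phi + c * a1, a1).
Proof.
move=> t01 a0s a1s da.
have t10 : 0 < t1 - t0 by rewrite subr_gt0.
pose v : R := (a1 - a0) / (t1 - t0).
have vr : `|v| <= rho.
  by rewrite normrM normfV [X in _ / X]gtr0_norm// ler_pdivrMr.
pose al (t : R) : R := a0 + (t - t0) * v.
have al0 : al t0 = a0 by rewrite /al subrr mul0r addr0.
have al1 : al t1 = a1 by rewrite /al /v mulrC divfK ?gt_eqF// addrC subrK.
have als t : t0 <= t <= t1 -> `|al t| < 1.
  move=> /andP[tt0 tt1]; pose s := (t - t0) / (t1 - t0).
  have s0 : 0 <= s by rewrite divr_ge0 ?subr_ge0// ltW.
  have s1 : s <= 1 by rewrite ler_pdivrMr// mul1r lerD2r.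
  have -> : al t = a0 * (1 - s) + a1 * s by rewrite /al /v /s; ring.
  pose m := Num.max `|a0| `|a1|.
  have m1 : m < 1 by rewrite gt_max a0s.
  have [a0m a1m] : `|a0| <= m /\ `|a1| <= m by rewrite !le_max !lexx orbT.
  apply: le_lt_trans m1; have -> : m = m * (1 - s) + m * s by ring.
  apply: le_normD; rewrite normrM [X in _ * X]ger0_norm ?subr_ge0//;
  by rewrite ler_wpM2r ?subr_ge0.
pose x' (t : R) : R := x + (cos phi * (X (al t) - X a0) - sin phi * (Y (al t) - Y a0)).
pose y' (t : R) : R := y + (sin phi * (X (al t) - X a0) + cos phi * (Y (al t) - Y a0)).
pose th (t : R) : R := phi + c * al t.
have D (t : R) : t0 <= t <= t1 -> [/\ is_derive t 1 x'
      ((cos (th t) * U c 1 (al t) - sin (th t) * W c 1 (al t)) * v),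
   is_derive t 1 y'
      ((sin (th t) * U c 1 (al t) + cos (th t) * W c 1 (al t)) * v),
   is_derive t 1 th (c * v) & is_derive t 1 al v].
  move=> /als ht; have [dX dY] := shapeXY ht.
  have dal : is_derive t 1 al v.
    by eapply is_derive_subst; [rewrite /al; derivation|move=> /=; ring].
  have dXal := is_derive_comp_fun dX dal; have dYal := is_derive_comp_fun dY dal.
  split => //; rewrite /th ?cosD ?sinD; (eapply is_derive_subst;
   [rewrite /x' /y' /th; derivation|rewrite /= /shapeX' /shapeY'; ring]).
exists x', y', th, al, (fun=> v), (fun=> 0); split; last 2 first.
- by rewrite /x' /y' /th al0 !subrr !mulr0 subrr !addr0.
- by rewrite /x' /y' /th al1.
split.
- split.
  + apply: (is_derive_lipschitz (df := fun t =>
      (cos (th t) * U c 1 (al t) - sin (th t) * W c 1 (al t)) * v)) => [t /D[]//|t _].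
    have [? ? _ _] := bodyB (al t).
    by have [] := @planar_bound (th t) (U c 1 (al t)) (W c 1 (al t)) v.
  + apply: (is_derive_lipschitz (df := fun t =>
      (sin (th t) * U c 1 (al t) + cos (th t) * W c 1 (al t)) * v)) => [t /D[]//|t _].
    have [? ? _ _] := bodyB (al t).
    by have [] := @planar_bound (th t) (U c 1 (al t)) (W c 1 (al t)) v.
  + apply: (@is_derive_lipschitz R th (fun=> c * v) t0 t1 K) => [t /D[]//|t _].
    apply: le_trans (le_normM (le_norm_id c) vr) (K_ge _).
    by move: B_ge0; lra.
  + apply: (is_derive_lipschitz (df := fun=> v)) => [t /D[]//|t _].
    apply: le_trans vr _; rewrite -[rho]mul1r; apply: K_ge.
    by have := normr_ge0 c; move: B_ge0; lra.
- split; [|exact: measurable_cst|exact: measurable_cst].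
  apply: continuous_measurable_fun; apply: (@is_derive_continuous R _ (fun=> v)) => t.
  by eapply is_derive_subst; [rewrite /al; derivation|move=> /=; ring].
- by move=> t; rewrite normr0.
exists [::] => t /andP[tt0 tt1] _; have [|dx dy dth dal] := D t; first by rewrite !ltW.
rewrite /driven mulr0 addr0 (mulrC c v).
have [EU EW] := body_scale v c 1 (al t); rewrite mulr1 in EU EW.
rewrite EU EW; split => //; last by rewrite mulrC.
- by eapply is_derive_subst; [exact: dx|ring].
- by eapply is_derive_subst; [exact: dy|ring].
Qed.

(** With v = 0 the velocity is constant in the body, and the motion is a rotation
about the body-fixed point (- W 1 0 a, U 1 0 a). *)
Lemma motion_spin_at (t0 t1 x y th0 b a : R) : t0 < t1 -> sin a != 0 ->
  `|b| <= rho * (t1 - t0) * `|sin a| ->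
  motion rho K t0 t1 (x, y, th0, a)
    (x + ((cos (th0 + b) - cos th0) * W 1 0 a + (sin (th0 + b) - sin th0) * U 1 0 a),
     y + ((sin (th0 + b) - sin th0) * W 1 0 a - (cos (th0 + b) - cos th0) * U 1 0 a),
     th0 + b, a).
Proof.
move=> t01 sa hb.
have t10 : 0 < t1 - t0 by rewrite subr_gt0.
have t10' : t1 - t0 != 0 by rewrite gt_eqF.
pose p : R := b / (t1 - t0) / sin a.
have pr : `|p| <= rho.
  rewrite !normrM !normfV [X in _ / X / _]gtr0_norm// !ler_pdivrMr ?normr_gt0//.
  by rewrite mulrAC.
have pr' : `|sin a * p| <= rho.
  by rewrite -[rho]mul1r; apply: le_normM => //; exact: le_sin1.
pose th (t : R) : R := th0 + (t - t0) * (sin a * p).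
have th1 : th t1 = th0 + b.
  by rewrite /th /p; congr (_ + _); field; rewrite sa t10'.
have tht0 : th t0 = th0 by rewrite /th subrr mul0r addr0.
pose x' (t : R) : R := x + ((cos (th t) - cos th0) * W 1 0 a
   + (sin (th t) - sin th0) * U 1 0 a).
pose y' (t : R) : R := y + ((sin (th t) - sin th0) * W 1 0 a
   - (cos (th t) - cos th0) * U 1 0 a).
have D (t : R) : [/\ is_derive t 1 x'
      ((cos (th t) * U 1 0 a - sin (th t) * W 1 0 a) * (sin a * p)),
   is_derive t 1 y'
      ((sin (th t) * U 1 0 a + cos (th t) * W 1 0 a) * (sin a * p)) &
   is_derive t 1 th (sin a * p)].
  have dth : is_derive t 1 th (sin a * p).
    by eapply is_derive_subst; [rewrite /th; derivation|move=> /=; ring].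
  by split => //; (eapply is_derive_subst;
    [rewrite /x' /y'; derivation|move=> /=; ring]).
exists x', y', th, (fun=> a), (fun=> 0), (fun=> p); split; last 2 first.
- by rewrite /x' /y' tht0 !subrr !mul0r subrr !addr0.
- by rewrite /x' /y' th1.
have [_ _ bU bW] := bodyB a.
split.
- split.
  + apply: (is_derive_lipschitz (df := fun t =>
      (cos (th t) * U 1 0 a - sin (th t) * W 1 0 a) * (sin a * p))) => t _.
      by have [] := D t.
    by have [] := @planar_bound (th t) _ _ _ bU bW pr'.
  + apply: (is_derive_lipschitz (df := fun t =>
      (sin (th t) * U 1 0 a + cos (th t) * W 1 0 a) * (sin a * p))) => t _.
      by have [] := D t.
    by have [] := @planar_bound (th t) _ _ _ bU bW pr'.
  + apply: (is_derive_lipschitz (df := fun=> sin a * p)) => t _; first by have [] := D t.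
    apply: le_trans pr' _; rewrite -[rho]mul1r; apply: K_ge.
    by have := normr_ge0 c; move: B_ge0; lra.
  + apply: (is_derive_lipschitz (df := fun=> 0)) => t _.
    rewrite normr0 -[0](mul0r rho); apply: K_ge.
    by have := normr_ge0 c; move: B_ge0; lra.
- by split; exact: measurable_cst.
- by move=> t; rewrite normr0.
exists [::] => t _ _; have [dx dy dth] := D t.
rewrite /driven mulr0 add0r.
have [EU EW] := body_scale (sin a * p) 1 0 a; rewrite mulr1 mulr0 in EU EW.
rewrite EU EW; split => //; last by eapply is_derive_cstr.
- by eapply is_derive_subst; [exact: dx|ring].
- by eapply is_derive_subst; [exact: dy|ring].
Qed.

Hypotheses (X0 : X 0 = 0) (Y0 : Y 0 = 0).
Hypothesis rho_gt0 : 0 < rho.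
Variable d : R.
Hypothesis d_gt0 : 0 < d.

(** * Steering by rotations about pivots *)

(** Motions that last n phases of duration d, whenever they start. *)
Definition reach (n : nat) (q q' : pose4) : Prop :=
  forall t0, motion rho K t0 (t0 + n%:R * d) q q'.

Lemma reach_trans (n m : nat) (q q' q'' : pose4) :
  reach n q q' -> reach m q' q'' -> reach (n + m) q q''.
Proof.
move=> h h' t0.
have nd (j : nat) : 0 <= j%:R * d by rewrite mulr_ge0// ltW.
apply: motion_trans (h t0) _; rewrite ?lerDl//.
  by rewrite natrD mulrDl addrA lerDl.
by rewrite natrD mulrDl addrA; exact: h'.
Qed.

Lemma reach_shape (x y phi a0 a1 : R) :
  `|a0| < 1 -> `|a1| < 1 -> `|a1 - a0| <= rho * d ->
  reach 1 (x, y, phi + c * a0, a0)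
    (x + (cos phi * (X a1 - X a0) - sin phi * (Y a1 - Y a0)),
     y + (sin phi * (X a1 - X a0) + cos phi * (Y a1 - Y a0)), phi + c * a1, a1).
Proof.
move=> a0s a1s da t0; apply: motion_shape => //; first by rewrite mul1r ltrDl.
by rewrite addrAC subrr add0r mul1r.
Qed.

Lemma reach_spin_at (x y th b a : R) : sin a != 0 -> `|b| <= rho * d * `|sin a| ->
  reach 1 (x, y, th, a)
    (x + ((cos (th + b) - cos th) * W 1 0 a + (sin (th + b) - sin th) * U 1 0 a),
     y + ((sin (th + b) - sin th) * W 1 0 a - (cos (th + b) - cos th) * U 1 0 a),
     th + b, a).
Proof.
move=> sa hb t0; apply: motion_spin_at => //; first by rewrite mul1r ltrDl.
by rewrite addrAC subrr add0r mul1r.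
Qed.

(** The centre of the rotation of [reach_spin], in the frame of the straight
swimmer. *)
Definition pivotX (a : R) : R := X a - cos (c * a) * W 1 0 a - sin (c * a) * U 1 0 a.
Definition pivotY (a : R) : R := Y a - sin (c * a) * W 1 0 a + cos (c * a) * U 1 0 a.

(** Bendings that can be reached within one phase, and at which p has an effect. *)
Definition amplitude (a : R) : Prop := [/\ `|a| < 1, `|a| <= rho * d & sin a != 0].

Lemma amplitudeN (a : R) : amplitude a -> amplitude (- a).
Proof. by rewrite /amplitude normrN sinN oppr_eq0. Qed.

(** Bend, turn, straighten: the two changes of shape are undone up to the rotation
in between, so that the whole is a rotation about a point. *)
Lemma reach_spin (x y th a b : R) : amplitude a -> `|b| <= rho * d * `|sin a| ->
  reach 3 (x, y, th, 0)
    (x + ((cos th - cos (th + b)) * pivotX a - (sin th - sin (th + b)) * pivotY a),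
     y + ((sin th - sin (th + b)) * pivotX a + (cos th - cos (th + b)) * pivotY a),
     th + b, 0).
Proof.
move=> [a1 ard sa] hb.
have n0 : `|0 : R| < 1 by rewrite normr0.
have S1 := reach_shape x y th n0 a1; rewrite subr0 mulr0 addr0 in S1.
have {}S1 := S1 ard.
have {S1} := reach_trans S1 (reach_spin_at _ _ (th + c * a) sa hb).
have S3 := fun x y => reach_shape x y (th + b) a1 n0.
rewrite sub0r normrN mulr0 addr0 in S3.
rewrite (addrAC th) => /reach_trans/(_ (S3 _ _ ard)).
congr (reach _ _ (_, _, _, _)).
- rewrite /pivotX /pivotY X0 Y0 !(cosD, sinD); ring.
- rewrite /pivotX /pivotY X0 Y0 !(cosD, sinD); ring.
Qed.

(** Rotations by -b/2, b, -b/2 about the pivots of a, a', a. The angles add up to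
zero, and the displacement is orthogonal to the line through the two pivots. *)
Lemma reach_translate (x y th a a' b : R) : amplitude a -> amplitude a' ->
  `|b| <= rho * d * `|sin a| -> `|b| <= rho * d * `|sin a'| ->
  let s := 2 * sin (b / 2) in
  let DX := pivotX a - pivotX a' in let DY := pivotY a - pivotY a' in
  reach 9 (x, y, th, 0)
    (x - s * (sin th * DX + cos th * DY), y + s * (cos th * DX - sin th * DY), th, 0).
Proof.
move=> ha ha' hb hb' s DX DY.
have hb2 : `|- (b / 2)| <= rho * d * `|sin a|.
  by rewrite normrN normrM normfV normr_nat; have := normr_ge0 b; lra.
have S1 := reach_spin x y th ha hb2.
have := reach_trans (reach_trans S1 (reach_spin _ _ _ ha' hb')) (reach_spin _ _ _ ha hb2).
have -> : th + - (b / 2) + b = th + b / 2 by field.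
have -> : th + b / 2 + - (b / 2) = th by ring.
congr (reach _ _ (_, _, _, _)).
- by rewrite /s /DX /DY !(cosD, sinD, cosN, sinN); ring.
- by rewrite /s /DX /DY !(cosD, sinD, cosN, sinN); ring.
Qed.

Lemma half_sine_onto (b0 : R) : 0 < b0 -> b0 < 1 ->
  exists2 s0, 0 < s0 & forall s, `|s| <= s0 -> exists2 b, `|b| <= b0 & 2 * sin (b / 2) = s.
Proof.
move=> b00 b01; pose f (b : R) : R := 2 * sin (b * 2^-1).
have fN b : f (- b) = - f b by rewrite /f mulNr sinN mulrN.
exists (f b0).
  by rewrite mulr_gt0// sin_gt0_pi//; have := pi_ge2 R; lra.
move=> s; rewrite ler_norml -fN => hs.
have lef : f (- b0) <= f b0 by case/andP: hs; exact: le_trans.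
have [|||b] := @IVT R f (- b0) b0 s; first by lra.
- apply: continuous_subspaceT; apply: (@is_derive_continuous R _ (fun b => cos (b * 2^-1))) => b.
  by eapply is_derive_subst; [rewrite /f; derivation|move=> /=; field].
- by rewrite min_l// max_r.
by rewrite in_itv/= -ler_norml => bb0 <-; exists b.
Qed.

Section Amplitude.
Variable a : R.
Hypothesis (ha : amplitude a) (a_pivot : pivotY a != pivotY (- a)).

(** [reach_translate] is used twice, the second time between two opposite spins by b0.
The spins cancel, but the direction of the second translation is rotated by b0,
so that the two directions are independent. *)
Lemma reach_translations : exists2 tau, 0 < tau & forall x y th tx ty,
  `|tx| <= tau -> `|ty| <= tau -> reach 24 (x, y, th, 0) (x + tx, y + ty, th, 0).
Proof.
have [_ _ sa] := ha; have haN := amplitudeN ha.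
pose b0 := Num.min (rho * d * `|sin a|) 2^-1.
have rd0 : 0 < rho * d * `|sin a|.
  by apply: mulr_gt0; [exact: mulr_gt0|rewrite normr_gt0].
have b00 : 0 < b0 by rewrite lt_min rd0; lra.
have b01 : b0 < 1 by rewrite gt_min; apply/orP; right; lra.
have b0a : b0 <= rho * d * `|sin a| by rewrite ge_min lexx.
have [s0 s00 hs0] := half_sine_onto b00 b01.
pose DX := pivotX a - pivotX (- a); pose DY := pivotY a - pivotY (- a).
have DY0 : DY != 0 by rewrite subr_eq0.
pose D := (DX ^+ 2 + DY ^+ 2) * sin b0.
have D0 : 0 < D.
  rewrite mulr_gt0//; first by rewrite ltr_wpDl ?sqr_ge0// exprn_even_gt0.
  by rewrite sin_gt0_pi//; have := pi_ge2 R; lra.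
pose L := `|DX| + `|DY|.
have L0 : 0 < L by rewrite ltr_wpDl// normr_gt0.
exists (s0 * D / (L + L)) => [|x y th tx ty txb tyb].
  by apply: divr_gt0; [exact: mulr_gt0|exact: addr_gt0].
have AL1 (phi : R) : `|- (sin phi * DX + cos phi * DY)| <= L.
  rewrite normrN /L -[`|DX|]mul1r -[`|DY|]mul1r.
  by apply: le_normD; apply: le_normM => //; [exact: le_sin1|exact: le_cos1].
have AL2 (phi : R) : `|cos phi * DX - sin phi * DY| <= L.
  rewrite /L -[`|DX|]mul1r -[`|DY|]mul1r.
  apply: le_normD; rewrite ?normrN; apply: le_normM => //.
    exact: le_cos1.
  exact: le_sin1.
(* (A1, A2) and (B1, B2) are the directions of the two translations. Their
   determinant is D, and Cramer's rule gives the lengths. *)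
pose A1 := - (sin th * DX + cos th * DY); pose A2 := cos th * DX - sin th * DY.
pose B1 := - (sin (th + b0) * DX + cos (th + b0) * DY).
pose B2 := cos (th + b0) * DX - sin (th + b0) * DY.
have DE : A1 * B2 - A2 * B1 = D.
  transitivity ((cos th ^+ 2 + sin th ^+ 2) * D); last by rewrite cos2Dsin2 mul1r.
  by rewrite /A1 /A2 /B1 /B2 /D !(cosD, sinD); ring.
have sb (u v z1 z2 : R) : `|u| <= L -> `|v| <= L ->
    `|z1| <= s0 * D / (L + L) -> `|z2| <= s0 * D / (L + L) ->
    `|(z1 * u - z2 * v) / D| <= s0.
  move=> uL vL z1b z2b; rewrite normrM normfV (gtr0_norm D0) ler_pdivrMr//.
  have -> : s0 * D = s0 * D / (L + L) * L + s0 * D / (L + L) * L.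
    by field; rewrite gt_eqF// addr_gt0.
  by apply: le_normD; rewrite ?normrN; apply: le_normM.
have [b1 b1b b1E] := hs0 _ (sb _ _ _ _ (AL2 (th + b0)) (AL1 (th + b0)) txb tyb).
have [b2 b2b b2E] := hs0 _ (sb _ _ _ _ (AL1 th) (AL2 th) tyb txb).
have bd (b : R) : `|b| <= b0 -> `|b| <= rho * d * `|sin a| by move=> /le_trans; apply.
have bdN (b : R) : `|b| <= b0 -> `|b| <= rho * d * `|sin (- a)|.
  by move=> /le_trans; apply; rewrite sinN normrN.
have b0b : `|b0| <= rho * d * `|sin a| by rewrite gtr0_norm.
have nb0b : `|- b0| <= rho * d * `|sin a| by rewrite normrN gtr0_norm.
have S1 := reach_translate x y th ha haN (bd _ b1b) (bdN _ b1b).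
have S2 := reach_trans S1 (reach_spin _ _ _ ha b0b).
have S3 := reach_trans S2 (reach_translate _ _ _ ha haN (bd _ b2b) (bdN _ b2b)).
have := reach_trans S3 (reach_spin _ _ _ ha nb0b).
rewrite addrK b1E b2E -/DX -/DY -/B1 -/B2 -/A1 -/A2.
have sol1 : (tx * B2 - ty * B1) / D * A1 + (ty * A1 - tx * A2) / D * B1 = tx.
  transitivity (tx * (A1 * B2 - A2 * B1) / D); first by ring.
  by rewrite DE mulfK// gt_eqF.
have sol2 : (tx * B2 - ty * B1) / D * A2 + (ty * A1 - tx * A2) / D * B2 = ty.
  transitivity (ty * (A1 * B2 - A2 * B1) / D); first by ring.
  by rewrite DE mulfK// gt_eqF.
congr (reach _ _ (_, _, _, _)).
- by rewrite -[in RHS]sol1 /A1 /B1; ring.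
- by rewrite -[in RHS]sol2 /A2 /B2; ring.
Qed.

(** One spin sets theta; the displacement that it causes is O(th' - th), and is
corrected by a translation. *)
Lemma reach_straight : exists2 tau, 0 < tau & forall x y th x' y' th',
  `|x' - x| <= tau -> `|y' - y| <= tau -> `|th' - th| <= tau ->
  reach 27 (x, y, th, 0) (x', y', th', 0).
Proof.
have [tau tau0 htau] := reach_translations; have [_ _ sa] := ha.
pose L := `|pivotX a| + `|pivotY a| + 1.
have L0 : 0 < L by rewrite ltr_wpDl// addr_ge0.
have L1 : 1 <= L by rewrite lerDr addr_ge0.
have rd0 : 0 < rho * d * `|sin a|.
  by apply: mulr_gt0; [exact: mulr_gt0|rewrite normr_gt0].
pose tau' := Num.min (rho * d * `|sin a|) (tau / (2 * L)).
exists tau' => [|x y th x' y' th' xb yb tb].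
  by rewrite lt_min rd0 divr_gt0// mulr_gt0.
have tL (z : R) : `|z| <= tau' -> `|z| * L <= tau / 2.
  move=> zb; have : `|z| <= tau / (2 * L) by apply: le_trans zb _; rewrite ge_min lexx orbT.
  move=> /(ler_wpM2r (ltW L0)); have -> // : tau / (2 * L) * L = tau / 2.
  by field; rewrite gt_eqF.
have small (z : R) : `|z| <= tau' -> `|z| <= tau / 2.
  by move=> /tL h; apply: le_trans h; rewrite ler_peMr.
pose b := th' - th; have thE : th + b = th' by rewrite /b addrC subrK.
have bb : `|b| <= rho * d * `|sin a| by apply: le_trans tb _; rewrite ge_min lexx.
have cb := cos_lipschitz th (th + b); have sb := sin_lipschitz th (th + b).
have eb : `|th - (th + b)| = `|b| by rewrite distrC addrAC subrr add0r.
rewrite eb mul1r in cb; rewrite eb mul1r in sb.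
have S1 := reach_spin x y th ha bb.
set x1 := (x + _) in S1; set y1 := (y + _) in S1.
have plane (p q z1 z2 : R) : `|p| <= `|b| -> `|q| <= `|b| ->
    `|p * pivotX a| + `|q * pivotY a| <= tau / 2.
  move=> pb qb; apply: le_trans (tL _ tb).
  rewrite !normrM /L !mulrDr mulr1 -[leLHS]addr0.
  by rewrite lerD// lerD// ler_wpM2r.
have x1b : `|x1 - x| <= tau / 2.
  rewrite /x1 addrAC subrr add0r; apply: le_trans (ler_normB _ _) _.
  exact: plane.
have y1b : `|y1 - y| <= tau / 2.
  rewrite /y1 addrAC subrr add0r; apply: le_trans (ler_normD _ _) _.
  exact: plane.
have dist (z z1 z' : R) : `|z' - z| <= tau' -> `|z1 - z| <= tau / 2 -> `|z' - z1| <= tau.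
  move=> /small h h'; have -> : z' - z1 = (z' - z) - (z1 - z) by ring.
  by apply: le_trans (ler_normB _ _) _; rewrite [leRHS]splitr lerD.
have := reach_trans S1 (htau x1 y1 (th + b) _ _ (dist _ _ _ xb x1b) (dist _ _ _ yb y1b)).
by rewrite thE [x1 + _]addrC subrK [y1 + _]addrC subrK.
Qed.

(** The swimmer is first straightened and finally bent to the required shape; the
straight positions that correspond to two close states are close. Total number of
phases: 1 + (3 + 24) + 1. *)
Lemma reach_near : exists2 tau, 0 < tau & forall x y th al x' y' th' al',
  `|x' - x| <= tau -> `|y' - y| <= tau -> `|th' - th| <= tau ->
  `|al| <= tau -> `|al'| <= tau ->
  reach 29 (x, y, th, al) (x', y', th', al').
Proof.
have [tau tau0 htau] := reach_straight.
have z1 : `|0 : R| < 1 by rewrite normr0.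
have [sX dX] : exists sX : R, is_derive (0 : R) 1 X sX.
  by exists (shapeX' P 0); have [] := shapeXY z1.
have [sY dY] : exists sY : R, is_derive (0 : R) 1 Y sY.
  by exists (shapeY' P 0); have [] := shapeXY z1.
have [r1 r10 hX] := is_derive_near dX ltr01.
have [r2 r20 hY] := is_derive_near dY ltr01.
pose L := `|sX| + 1 + (`|sY| + 1).
have L2 : 2 <= L.
  by rewrite /L; have := normr_ge0 sX; have := normr_ge0 sY; lra.
have XYb (t : R) : `|t| < r1 -> `|t| < r2 -> `|X t| + `|Y t| <= L * `|t|.
  move=> tr1 tr2; have := hX t; have := hY t; rewrite X0 Y0 !subr0 !mul1r.
  move=> /(_ tr2) h2 /(_ tr1) h1.
  rewrite -[X t](subrK (sX * t)) -[Y t](subrK (sY * t)).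
  rewrite /L mulrDl; apply: lerD; (apply: le_trans (ler_normD _ _) _;
    rewrite normrM [leRHS]mulrDl mul1r [leRHS]addrC; exact: lerD).
pose M := 1 + 2 * L + 2 * `|c|.
have M0 : 0 < M by have := normr_ge0 c; rewrite /M; lra.
pose s := Num.min (Num.min (r1 / 2) (r2 / 2)) (Num.min (Num.min 2^-1 (rho * d)) (tau / M)).
have s0 : 0 < s by rewrite !lt_min !divr_gt0// mulr_gt0//; lra.
have [sr1 sr2 s2 srd sM] : [/\ s <= r1 / 2, s <= r2 / 2, s <= 2^-1, s <= rho * d & s <= tau / M].
  by split; rewrite !ge_min lexx ?orbT.
have sMt : s * M <= tau by rewrite -ler_pdivlMr.
exists s => // x y th al x' y' th' al' xb yb tb ab ab'.
pose phi := th - c * al; pose phi' := th' - c * al'.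
have lt1 (z : R) : `|z| <= s -> `|z| < 1 by move=> h; lra.
have S1 := @reach_shape x y phi al 0 (lt1 _ ab) z1; rewrite sub0r normrN in S1.
have {}S1 := S1 (le_trans ab srd); rewrite /phi subrK mulr0 addr0 -/phi X0 Y0 !sub0r in S1.
set x1 := (x + _) in S1; set y1 := (y + _) in S1.
pose x2 := x' - (cos phi' * X al' - sin phi' * Y al').
pose y2 := y' - (sin phi' * X al' + cos phi' * Y al').
have S3 := @reach_shape x2 y2 phi' 0 al' z1 (lt1 _ ab'); rewrite subr0 in S3.
have {}S3 := S3 (le_trans ab' srd).
rewrite /phi' subrK mulr0 addr0 -/phi' X0 Y0 !subr0 !subrK in S3.
have rotb (psi t : R) : `|t| <= s ->
    `|cos psi * X t - sin psi * Y t| <= L * s /\ `|sin psi * X t + cos psi * Y t| <= L * s.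
  move=> ts; have tb' : `|X t| + `|Y t| <= L * s.
    apply: le_trans (XYb _ _ _) _; [lra|lra|].
    by rewrite ler_wpM2l//; lra.
  have [cs1 sn1] := (le_cos1 psi, le_sin1 psi).
  split; (apply: le_trans tb'; apply: le_normD; rewrite ?normrN -[leRHS]mul1r; exact: le_normM).
have [rx ry] := rotb phi al ab; have [rx' ry'] := rotb phi' al' ab'.
have sum3 (z w w' : R) : `|z| <= s -> `|w| <= L * s -> `|w'| <= L * s ->
    `|z - w' + w| <= tau.
  move=> zs ws ws'; apply: le_trans sMt.
  have -> : s * M = s + L * s + L * s + 2 * `|c| * s by rewrite /M; ring.
  rewrite -[leLHS]addr0; apply: lerD; last by rewrite !mulr_ge0// ltW.
  by apply: le_normD => //; apply: le_normD; rewrite ?normrN.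
have S2 : reach 27 (x1, y1, phi, 0) (x2, y2, phi', 0).
  apply: htau.
  - have -> : x2 - x1 = (x' - x) - (cos phi' * X al' - sin phi' * Y al')
       + (cos phi * X al - sin phi * Y al) by rewrite /x1 /x2; ring.
    exact: sum3.
  - have -> : y2 - y1 = (y' - y) - (sin phi' * X al' + cos phi' * Y al')
       + (sin phi * X al + cos phi * Y al) by rewrite /y1 /y2; ring.
    exact: sum3.
  - have -> : phi' - phi = (th' - th) + (c * al - c * al') by rewrite /phi /phi'; ring.
    apply: le_trans sMt.
    have -> : s * M = s + (`|c| * s + `|c| * s) + 2 * L * s by rewrite /M; ring.
    rewrite -[leLHS]addr0; apply: lerD; last by rewrite !mulr_ge0//; lra.
    by apply: le_normD => //; apply: le_normD; rewrite ?normrN; exact: le_normM.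
exact: reach_trans (reach_trans S1 S2) S3.
Qed.

End Amplitude.
End Motions.

(** * The magnetic fields that produce a motion *)

Lemma measurable_inv (R : realType) : measurable_fun [set: R] (fun x : R => x^-1).
Proof.
have -> : [set: R] = ~` [set 0] `|` [set 0] by rewrite setUC setUv.
apply/measurable_funU => //; first exact: measurableC.
split; last exact: measurable_fun_set1.
apply: open_continuous_measurable_fun; first exact/closed_openC/accessible_closed_set1/hausdorff_accessible/norm_hausdorff.
by move=> x; rewrite inE/= => /eqP x0; exact: inv_continuous.
Qed.

Ltac measurability := repeat match goal with
  | |- measurable_fun _ (fun _ => _ + _) => apply: measurable_funD
  | |- measurable_fun _ (fun _ => - _) => apply: measurable_funN
  | |- measurable_fun _ (fun _ => _ * _) => apply: measurable_funM
  | |- measurable_fun _ (fun _ => _^-1) =>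
      apply: (measurableT_comp (@measurable_inv _))
  | |- measurable_fun _ (fun _ => cos _) =>
      apply: (measurableT_comp (continuous_measurable_fun (@continuous_cos _)))
  | |- measurable_fun _ (fun _ => sin _) =>
      apply: (measurableT_comp (continuous_measurable_fun (@continuous_sin _)))
  | |- measurable_fun _ _ => first [assumption | exact: measurable_cst]
  end.

Section Controls.
Variables (R : realType) (P : swimmer R).
Local Notation l1 := (ell1 P).
Local Notation l2 := (ell2 P).
Local Notation e2 := (eta2 P).
Local Notation k := (kappa P).
Local Notation m1 := (M1 P).
Local Notation m2 := (M2 P).
Local Notation c := (gait_slope P).
Hypotheses (l1_gt0 : 0 < l1) (l2_gt0 : 0 < l2).
Hypotheses (x1_gt0 : 0 < xi1 P) (x2_gt0 : 0 < xi2 P).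
Hypotheses (e1_gt0 : 0 < eta1 P) (e2_gt0 : 0 < e2).
Hypotheses (k_gt0 : 0 < k) (m1_neq0 : m1 != 0) (m2_neq0 : m2 != 0).
Hypothesis nondeg : torque_balance P 1 0 0 != 0.

Definition gait_rate (al v p : R) : R := c * v + sin al * p.

(** The transverse field is given by the torque on the second link, and the parallel
field by the torque on the first one. Where sin(alpha) = 0 the division yields
the value 0, and the parallel field is multiplied by 0 in the equations. *)
Definition Hperp_of (al v p : R) : R :=
  - (torque2 P (bodyW P (gait_rate al v p) v al) (gait_rate al v p) + k * al) * m2^-1.

Definition Hpar_of (al v p : R) : R :=
  (torque_balance P (gait_rate al v p) v al - k * al * (1 + m1 / m2 * cos al))
  * (m1 * sin al)^-1.

Lemma measurable_controls (al v p : R -> R) :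
  measurable_fun setT al -> measurable_fun setT v -> measurable_fun setT p ->
  measurable_fun setT (fun t => Hpar_of (al t) (v t) (p t)) /\
  measurable_fun setT (fun t => Hperp_of (al t) (v t) (p t)).
Proof.
move=> ma mv mp; split.
  rewrite /Hpar_of /torque_balance /torque1 /torque2 /bodyU /bodyW /drag_det /gait_rate.
  by measurability.
rewrite /Hperp_of /torque2 /bodyW /drag_det /gait_rate.
by measurability.
Qed.

(** In a shape with sin(al) = 0 the parallel field has no effect; the equation then
holds because the balance of the gait vanishes at alpha = 0. *)
Lemma controls_swim_eq (al v p : R) : (sin al = 0 -> al = 0) ->
  swim_eq P (Hpar_of al v p) (Hperp_of al v p) al
    (bodyU P (gait_rate al v p) v al) (bodyW P (gait_rate al v p) v al)
    (gait_rate al v p) v.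
Proof.
move=> sal; split; [exact: forceX_body|exact: forceY_body| |]; last first.
  by rewrite /Hperp_of; field.
have [sal0|san] := eqVneq (sin al) 0.
  have al0 := sal sal0.
  have := torque_balance_linear P v 0 c 1 0 0 0.
  rewrite torque_balance_gait0// !(mulr0, mul0r, addr0) mulr1 /torque_balance => tb.
  rewrite sal0 mul0r subr0 /Hperp_of /gait_rate al0 sin0 mul0r addr0 cos0.
  rewrite cos0 mulr1 (mulrC v c) in tb.
  apply/eqP; rewrite -subr_eq0; apply/eqP; rewrite -[RHS]tb; field.
  exact: m2_neq0.
rewrite /Hpar_of /Hperp_of /torque_balance.
by field; rewrite m1_neq0 san m2_neq0.
Qed.

(** On the gait the balance is v times a quantity that is O(sin al), plus sin al times
p times a bounded one; after division by M1 sin al both are O(rho). The elastic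
term is estimated by |al| <= 2 |sin al|, whence the factor 2. *)
Lemma controls_small (e : R) : 0 < e -> exists r A : R, [/\ 0 < r, r < 1, 0 < A &
  forall rho al v p : R, `|al| <= r -> `|v| <= rho -> `|p| <= rho ->
  [/\ swim_eq P (Hpar_of al v p) (Hperp_of al v p) al
       (bodyU P (gait_rate al v p) v al) (bodyW P (gait_rate al v p) v al)
       (gait_rate al v p) v,
    `|Hperp_of al v p| <= A * rho + e &
    `|Hpar_of al v p| <= 2 * k * `|(m2 + m1) / (m2 * m1)| + A * rho + e]].
Proof.
move=> e0.
have m10 : 0 < `|m1| by rewrite normr_gt0.
have m20 : 0 < `|m2| by rewrite normr_gt0.
(* Chosen so that replacing cos al by 1 in the elastic term costs at most e. *)
pose eta := e * `|m2| / (2 * k).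
have eta0 : 0 < eta by rewrite divr_gt0// mulr_gt0.
have [r [C [r0 r1 hr]]] := near_straight l1_gt0 l2_gt0 x1_gt0 x2_gt0 e1_gt0 e2_gt0 nondeg eta0.
have [CB hCB] := torque_balance_bounded l1_gt0 l2_gt0 x1_gt0 x2_gt0 e1_gt0 e2_gt0 1 0.
have [B1 hB1] := body_bounded l1_gt0 l2_gt0 x1_gt0 x2_gt0 e1_gt0 e2_gt0 c 1.
have [B2 hB2] := body_bounded l1_gt0 l2_gt0 x1_gt0 x2_gt0 e1_gt0 e2_gt0 1 0.
pose A1 := (`|- (1 / 2) * e2 * l2 ^+ 2| * (B1 + B2)
  + `|1 / 12 * e2 * l2 ^+ 3| * (`|c| + 1)) / `|m2|.
pose A2 := (`|C| + `|CB|) / `|m1|.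
have B10 : 0 <= B1 by have [h _] := hB1 0; exact: le_trans h.
have B20 : 0 <= B2 by have [h _] := hB2 0; exact: le_trans h.
have A10 : 0 <= A1.
  by rewrite divr_ge0// addr_ge0// mulr_ge0// addr_ge0.
have A20 : 0 <= A2 by rewrite divr_ge0// addr_ge0.
pose r' := Num.min r (e * `|m2| / k).
exists r', (A1 + A2 + 1); split.
- by rewrite lt_min r0 divr_gt0// mulr_gt0.
- by rewrite gt_min r1.
- by rewrite ltr_wpDl// addr_ge0.
move=> rho al v p alr vr pr.
have [alr1 alr2] : `|al| <= r /\ `|al| <= e * `|m2| / k.
  by move: alr; rewrite le_min => /andP[].
have rho0 : 0 <= rho by exact: le_trans vr.
have [al2 Zb cb] := hr al alr1.
have sal : sin al = 0 -> al = 0.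
  by move=> s0; move: al2; rewrite s0 normr0 mulr0 normr_le0 => /eqP.
split; first exact: controls_swim_eq.
- have -> : (A1 + A2 + 1) * rho + e = A1 * rho + e + (A2 * rho + rho) by ring.
  rewrite -[leLHS]addr0; apply: lerD; last by rewrite addr_ge0// mulr_ge0.
  have WE : bodyW P (gait_rate al v p) v al =
      v * bodyW P c 1 al + (sin al * p) * bodyW P 1 0 al.
    by rewrite -bodyW_linear /gait_rate; congr (bodyW _ _ _ _); ring.
  have sp : `|sin al * p| <= rho.
    by rewrite -[rho]mul1r; apply: le_normM => //; exact: le_sin1.
  have Wb : `|bodyW P (gait_rate al v p) v al| <= (B1 + B2) * rho.
    rewrite WE mulrDl !(mulrC _ rho); apply: le_normD; apply: le_normM => //.
      by have [] := hB1 al.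
    by have [] := hB2 al.
  have gb : `|gait_rate al v p| <= (`|c| + 1) * rho.
    by rewrite /gait_rate [leRHS]mulrDl mul1r; apply: le_normD => //; exact: le_normM.
  rewrite /Hperp_of normrM normrN normfV ler_pdivrMr//.
  have -> : (A1 * rho + e) * `|m2| =
    (`|- (1 / 2) * e2 * l2 ^+ 2| * ((B1 + B2) * rho)
     + `|1 / 12 * e2 * l2 ^+ 3| * ((`|c| + 1) * rho)) + e * `|m2|.
    by rewrite /A1; field; rewrite gt_eqF.
  apply: le_normD; last first.
    by rewrite normrM gtr0_norm// mulrC -ler_pdivlMr.
  by rewrite /torque2; apply: le_normD; rewrite ?normrN; apply: le_normM.
- have -> : 2 * k * `|(m2 + m1) / (m2 * m1)| + (A1 + A2 + 1) * rho + e =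
     (A2 * rho + (2 * k * `|(m2 + m1) / (m2 * m1)| + e)) + (A1 * rho + rho) by ring.
  rewrite -[leLHS]addr0; apply: lerD; last by rewrite addr_ge0// mulr_ge0.
  have [sal0|san] := eqVneq (sin al) 0.
    rewrite /Hpar_of sal0 mulr0 invr0 mulr0 normr0.
    by have k0 := ltW k_gt0; have e0' := ltW e0; rewrite !(addr_ge0, mulr_ge0).
  have sn0 : 0 < `|sin al| by rewrite normr_gt0.
  have tbE : torque_balance P (gait_rate al v p) v al =
     v * torque_balance P c 1 al + (sin al * p) * torque_balance P 1 0 al.
    by rewrite -torque_balance_linear /gait_rate; congr (torque_balance _ _ _ _); ring.
  rewrite /Hpar_of normrM normfV ler_pdivrMr ?(normrM m1) ?mulr_gt0//.
  rewrite mulrDl; apply: le_normD.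
    rewrite tbE.
    have -> : A2 * rho * (`|m1| * `|sin al|) =
       rho * (`|C| * `|sin al|) + `|sin al| * rho * `|CB|.
      by rewrite /A2; field; rewrite gt_eqF.
    apply: le_normD; apply: le_normM => //.
    - by apply: le_trans Zb _; rewrite ler_wpM2r// ler_norm.
    - exact: le_normM.
    - by apply: le_trans (hCB al) (ler_norm _).
  rewrite normrN.
  have -> : 1 + m1 / m2 * cos al = (m2 + m1) / m2 + m1 / m2 * (cos al - 1).
    by field.
  have -> : (2 * k * `|(m2 + m1) / (m2 * m1)| + e) * (`|m1| * `|sin al|) =
     k * (2 * `|sin al|) * (`|(m2 + m1) / m2| + `|m1 / m2| * eta).
    rewrite /eta !(normrM, normfV); field.
    by rewrite !gt_eqF.
  apply: le_normM.
    by apply: le_normM => //; rewrite gtr0_norm.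
  by apply: le_normD => //; exact: le_normM.
Qed.

End Controls.

Lemma trig_periodic (R : realType) (a : R) (j : int) :
  cos (a + j%:~R * (pi *+ 2)) = cos a /\ sin (a + j%:~R * (pi *+ 2)) = sin a.
Proof.
have nat_case n (b : R) :
    cos (b + n%:R * (pi *+ 2)) = cos b /\ sin (b + n%:R * (pi *+ 2)) = sin b.
  by rewrite mulr_natl; split; apply: periodicn; [exact: cosD2pi|exact: sinD2pi].
case: j => n; first exact: nat_case.
rewrite NegzE rmorphN mulNr; have [] := nat_case n.+1 (a - n.+1%:R * (pi *+ 2)).
by rewrite subrK => -> ->.
Qed.

Lemma Linfty_norm_le (R : realType) (T b : R) (H : R -> R) : 0 <= b ->
  (forall t, 0 <= t <= T -> `|H t| <= b) -> (Linfty_norm T H <= b%:E)%E.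
Proof.
move=> b0 Hb; rewrite /Linfty_norm unlock; case: ifP => _; last by rewrite lee_fin.
apply/ess_supP; apply: nearW => t /=; rewrite lee_fin /patch.
case: ifPn => [|_]; last by rewrite normr0.
by rewrite inE/= in_itv/=; exact: Hb.
Qed.

Lemma bounded_of_le (R : realType) (T b : R) (H : R -> R) :
  (forall t, 0 <= t <= T -> `|H t| <= b) -> [bounded H t | t in `[0, T]].
Proof.
move=> Hb; rewrite /bounded_near; near=> M => t /=; rewrite in_itv/= => /Hb Hbt; apply: (le_trans Hbt).
by near: M; apply: nbhs_pinfty_ge; rewrite num_real.
Unshelve. all: by end_near. Qed.

(** The difference f a - f (- a) is 2 D a at first order. *)
Lemma derive_neq0_asymmetric (R : realType) (f : R -> R) (D b : R) :
  is_derive (0 : R) 1 f D -> D != 0 -> 0 < b ->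
  exists a, [/\ 0 < a, a < b & f a != f (- a)].
Proof.
move=> df D0 b0; have e0 : 0 < `|D| / 2 by rewrite divr_gt0 ?normr_gt0.
have [r r0 hr] := is_derive_near df e0.
have [a [a0 ar ab]] : exists a, [/\ 0 < a, a < r & a < b].
  have m0 : 0 < Num.min r b by rewrite lt_min r0.
  have [mr mb] : Num.min r b <= r /\ Num.min r b <= b by rewrite !ge_min !lexx orbT.
  by exists (Num.min r b / 2); split; lra.
exists a; split => //; rewrite -(gtr0_norm a0) in ar.
apply/eqP => E; have := hr a; have := hr (- a).
rewrite !subr0 normrN => /(_ ar) h1 /(_ ar) h2.
have : `|(f a - f 0 - D * a) - (f (- a) - f 0 - D * - a)| <= `|D| / 2 * `|a| + `|D| / 2 * `|a|.
  by apply: le_normD; rewrite ?normrN.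
rewrite E; have -> : f (- a) - f 0 - D * a - (f (- a) - f 0 - D * - a) = - (2 * D * a) by ring.
rewrite normrN !normrM normr_nat; have : 0 < `|D| * `|a| by rewrite mulr_gt0 ?normr_gt0// gt_eqF.
lra.
Qed.

Lemma state_box_sub (R : realType) (x0 y0 th0 r r' : R) : r <= r' ->
  state_box x0 y0 th0 r `<=` state_box x0 y0 th0 r'.
Proof.
move=> rr' _ [x [y [th [al [-> hx hy [ht ha]]]]]]; exists x, y, th, al.
by split => //; [| |split]; apply: lt_le_trans rr'.
Qed.

Section Steering.
Variables (R : realType) (P : swimmer R).
Local Notation c := (gait_slope P).
Hypotheses (l1_gt0 : 0 < ell1 P) (l2_gt0 : 0 < ell2 P).
Hypotheses (x1_gt0 : 0 < xi1 P) (x2_gt0 : 0 < xi2 P).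
Hypotheses (e1_gt0 : 0 < eta1 P) (e2_gt0 : 0 < eta2 P).

(** The lift of theta is determined up to full turns only. *)
Lemma driven_shift (x y th al v p : R -> R) (t : R) (j : int) :
  driven P x y th al v p t ->
  driven P x y (fun s => th s + j%:~R * (pi *+ 2)) al v p t.
Proof.
have [cE sE] := trig_periodic (th t) j.
move=> [dx dy dth dal]; rewrite /driven cE sE; split => //.
by eapply is_derive_subst; [derivation|rewrite /= addr0].
Qed.

Lemma driven_satisfies_S (T : R) (Hpar Hperp x y th al v p : R -> R) (s : seq R) :
  (forall t, 0 < t < T -> t \notin s -> driven P x y th al v p t) ->
  (forall t, 0 <= t <= T -> swim_eq P (Hpar t) (Hperp t) (al t)
    (bodyU P (gait_rate P (al t) (v t) (p t)) (v t) (al t))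
    (bodyW P (gait_rate P (al t) (v t) (p t)) (v t) (al t))
    (gait_rate P (al t) (v t) (p t)) (v t)) ->
  satisfies_S P T Hpar Hperp x y th al.
Proof.
move=> hs E; apply: negligibleS (negligible_seq s) => t /= nS.
apply: contrapT => /negP ts; apply: nS; rewrite in_itv/= => tT.
have [dx dy dth dal] := hs t tT ts.
have {}E : swim_eq _ _ _ _ _ _ _ _ := E t _.
rewrite !derive1E; split; [by case: dx|by case: dy|by case: dth|by case: dal|].
rewrite (@derive_val _ _ _ _ _ _ _ dx) (@derive_val _ _ _ _ _ _ _ dy).
rewrite (@derive_val _ _ _ _ _ _ _ dth) (@derive_val _ _ _ _ _ _ _ dal).
apply/Mh_eqP.
set U := bodyU _ _ _ _; set W := bodyW _ _ _ _.
have cs := cos2Dsin2 (th t).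
have -> : cos (th t) * (cos (th t) * U - sin (th t) * W)
   + sin (th t) * (sin (th t) * U + cos (th t) * W) = U.
  by rewrite -[RHS]mul1r -cs; ring.
have -> : - sin (th t) * (cos (th t) * U - sin (th t) * W)
   + cos (th t) * (sin (th t) * U + cos (th t) * W) = W.
  by rewrite -[RHS]mul1r -cs; ring.
by apply: E; case/andP: tT => /ltW -> /ltW ->.
Qed.

Lemma driven_bounded (B rho : R) (x y th al v p : R -> R) (t : R) :
  [/\ `|bodyU P c 1 (al t)| <= B, `|bodyW P c 1 (al t)| <= B,
      `|bodyU P 1 0 (al t)| <= B & `|bodyW P 1 0 (al t)| <= B] ->
  `|v t| <= rho -> `|p t| <= rho -> driven P x y th al v p t ->
  let D := (4 * B + `|c| + 1) * rho in
  [/\ `|derive1 x t| <= D, `|derive1 y t| <= D,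
      `|derive1 th t| <= D & `|derive1 al t| <= D].
Proof.
move=> [U1 W1 U2 W2] vr pr [dx dy dth dal] D.
have rho0 : 0 <= rho by exact: le_trans vr.
have B0 : 0 <= B by exact: le_trans U1.
have sp : `|sin (al t) * p t| <= rho.
  by rewrite -[rho]mul1r; apply: le_normM => //; exact: le_sin1.
have Ub : `|bodyU P (c * v t + sin (al t) * p t) (v t) (al t)| <= 2 * B * rho.
  have -> : bodyU P (c * v t + sin (al t) * p t) (v t) (al t) =
      v t * bodyU P c 1 (al t) + (sin (al t) * p t) * bodyU P 1 0 (al t).
    by rewrite -bodyU_linear; congr (bodyU _ _ _ _); ring.
  have -> : 2 * B * rho = rho * B + rho * B by ring.
  by apply: le_normD; exact: le_normM.
have Wb : `|bodyW P (c * v t + sin (al t) * p t) (v t) (al t)| <= 2 * B * rho.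
  have -> : bodyW P (c * v t + sin (al t) * p t) (v t) (al t) =
      v t * bodyW P c 1 (al t) + (sin (al t) * p t) * bodyW P 1 0 (al t).
    by rewrite -bodyW_linear; congr (bodyW _ _ _ _); ring.
  have -> : 2 * B * rho = rho * B + rho * B by ring.
  by apply: le_normD; exact: le_normM.
have DE : D = (1 * (2 * B * rho) + 1 * (2 * B * rho)) + (`|c| + 1) * rho by rewrite /D; ring.
have c0 : 0 <= (`|c| + 1) * rho by rewrite mulr_ge0// addr_ge0.
have BB : 0 <= 1 * (2 * B * rho) + 1 * (2 * B * rho) by rewrite mul1r addr_ge0// !mulr_ge0.
have [cs1 sn1] := (le_cos1 (th t), le_sin1 (th t)).
rewrite !derive1E.
rewrite (@derive_val _ _ _ _ _ _ _ dx) (@derive_val _ _ _ _ _ _ _ dy).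
rewrite (@derive_val _ _ _ _ _ _ _ dth) (@derive_val _ _ _ _ _ _ _ dal).
split.
- apply: (@le_trans _ _ (1 * (2 * B * rho) + 1 * (2 * B * rho))).
    by apply: le_normD; rewrite ?normrN; exact: le_normM.
  by rewrite DE lerDl.
- apply: (@le_trans _ _ (1 * (2 * B * rho) + 1 * (2 * B * rho))).
    by apply: le_normD; rewrite ?normrN; exact: le_normM.
  by rewrite DE lerDl.
- apply: (@le_trans _ _ ((`|c| + 1) * rho)); last by rewrite DE lerDr.
  by rewrite mulrDl mul1r; apply: le_normD => //; exact: le_normM.
- apply: (le_trans vr); rewrite DE; apply: (@le_trans _ _ ((`|c| + 1) * rho)).
    by rewrite ler_peMl// lerDr.
  by rewrite lerDr.
Qed.

(** The motion is a solution for the fields computed from it, and the only one: the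
lift of theta of another solution may differ by full turns at time 0, and
[satisfies_S_unique] applies to the motion shifted by as much. *)
Lemma motion_realized (T rho K B h1 h2 : R) (x y th al v p : R -> R) : 0 < T ->
  (forall a, [/\ `|bodyU P c 1 a| <= B, `|bodyW P c 1 a| <= B,
     `|bodyU P 1 0 a| <= B & `|bodyW P 1 0 a| <= B]) ->
  motion_along P rho K 0 T x y th al v p -> `|al 0| < pi ->
  (forall t, 0 <= t <= T ->
     [/\ swim_eq P (Hpar_of P (al t) (v t) (p t)) (Hperp_of P (al t) (v t) (p t)) (al t)
       (bodyU P (gait_rate P (al t) (v t) (p t)) (v t) (al t))
       (bodyW P (gait_rate P (al t) (v t) (p t)) (v t) (al t))
       (gait_rate P (al t) (v t) (p t)) (v t),
       `|Hperp_of P (al t) (v t) (p t)| <= h1 &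
       `|Hpar_of P (al t) (v t) (p t)| <= h2]) ->
  let Hpar := fun t => Hpar_of P (al t) (v t) (p t) in
  let Hperp := fun t => Hperp_of P (al t) (v t) (p t) in
  let z := fun t => (x t, y t, angle (th t), angle (al t)) : state R in
  [/\ [/\ measurable_fun `[0, T] Hpar, measurable_fun `[0, T] Hperp,
          [bounded Hpar t | t in `[0, T]] & [bounded Hperp t | t in `[0, T]]],
      (Linfty_norm T Hperp <= h1%:E)%E, (Linfty_norm T Hpar <= h2%:E)%E,
      solution P T Hpar Hperp z &
      forall z', solution P T Hpar Hperp z' -> z' 0 = z 0 ->
        forall t, 0 <= t <= T -> z' t = z t].
Proof.
move=> T0 hB [[Lx Ly Lt La] [Ma Mv Mp] vp [s hs]] al0 hctl Hpar Hperp z.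
have h1b t : 0 <= t <= T -> `|Hperp t| <= h1 by move=> /hctl[].
have h2b t : 0 <= t <= T -> `|Hpar t| <= h2 by move=> /hctl[].
have T00 : 0 <= (0 : R) <= T by rewrite lexx ltW.
have [mHpar mHperp] := measurable_controls P Ma Mv Mp.
have AC f : lipschitz_itv K 0 T f -> abs_continuous 0 T f.
  exact: lipschitz_abs_continuous.
have ACth j : abs_continuous 0 T (fun t => th t + j%:~R * (pi *+ 2)).
  apply: AC => u t uT tT.
  have -> : th t + j%:~R * (pi *+ 2) - (th u + j%:~R * (pi *+ 2)) = th t - th u.
    by ring.
  exact: Lt.
have S j : satisfies_S P T Hpar Hperp x y (fun t => th t + j%:~R * (pi *+ 2)) al.
  apply: (@driven_satisfies_S T _ _ _ _ _ _ v p s).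
    by move=> t tT ts; apply: driven_shift; exact: hs.
  by move=> t /hctl[].
split.
- split.
  + exact: measurable_funTS.
  + exact: measurable_funTS.
  + exact: bounded_of_le h2b.
  + exact: bounded_of_le h1b.
- by apply: Linfty_norm_le => //; exact: le_trans (h1b 0 T00).
- by apply: Linfty_norm_le => //; exact: le_trans (h2b 0 T00).
- exists x, y, (fun t => th t + 0%:~R * (pi *+ 2)), al; split => //.
  + by move=> t _; rewrite mul0r addr0.
  + by split; [exact: AC|exact: AC|exact: ACth|exact: AC].
  + by move: al0; rewrite ltr_norml in_itv/= => /andP[-> /ltW ->].
move=> z' [x' [y' [th' [al' [zE' [acx acy act aca] al'0 S']]]]] z0.
have : z' 0 = z 0 := z0.
rewrite zE'; last by rewrite in_itv.
rewrite /z => -[ex ey /esym/angleP[j jE] /(angle_inj_pi al'0 al0) ea].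
pose D := (4 * B + `|c| + 1) * rho.
have vr t : `|v t| <= rho by have [] := vp t.
have pr t : `|p t| <= rho by have [] := vp t.
have D0 : 0 <= D.
  have [hB0 _ _ _] := hB 0; rewrite mulr_ge0//; last exact: le_trans (vr 0).
  by rewrite !addr_ge0// mulr_ge0//; exact: le_trans hB0.
have h10 : 0 <= h1 by exact: le_trans (h1b 0 T00).
have h20 : 0 <= h2 by exact: le_trans (h2b 0 T00).
have U := satisfies_S_unique l1_gt0 l2_gt0 x1_gt0 x2_gt0 e1_gt0 e2_gt0 (B := D + h1 + h2)
  (And4 acx acy act aca) (And4 (AC _ Lx) (AC _ Ly) (ACth j) (AC _ La)) S' (S j).
move=> t tT; have [||e1 e2 e3 e4] := U _ _ t tT; last first.
- rewrite zE'; last by rewrite in_itv.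
  by rewrite e1 e2 e3 e4 angleDpi.
- by split => //; rewrite -jE addrC subrK.
apply: negligibleS (negligible_seq s) => u /= nB.
apply: contrapT => /negP us; apply: nB; rewrite in_itv/= => uT.
have uT' : 0 <= u <= T by case/andP: uT => /ltW -> /ltW ->.
have [b1 b2 b3 b4] := driven_bounded (hB (al u)) (vr u) (pr u) (driven_shift j (hs u uT us)).
have Dle : D <= D + h1 + h2 by rewrite -addrA lerDl addr_ge0.
split; split; try exact: le_trans Dle.
- by apply: le_trans (h2b u uT') _; rewrite lerDr addr_ge0.
- by apply: le_trans (h1b u uT') _; rewrite addrAC lerDr addr_ge0.
Qed.

End Steering.

(** * Local controllability *)

Theorem theorem3p4 (R : realType)
  (l1 l2 xi1 xi2 eta1 eta2 kappa M1 M2 : R)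
  (l1_gt0 : 0 < l1) (l2_gt0 : 0 < l2)
  (xi1_gt0 : 0 < xi1) (xi2_gt0 : 0 < xi2)
  (eta1_gt0 : 0 < eta1) (eta2_gt0 : 0 < eta2)
  (kappa_gt0 : 0 < kappa)
  (M1_neq0 : M1 != 0) (M2_neq0 : M2 != 0)
  (anisotropic : (eta1 - xi1, eta2 - xi2) != (0, 0))
  (le_xi1_eta1 : xi1 <= eta1) (le_xi2_eta2 : xi2 <= eta2)
  (nondegenerate :
    (3 + 4 * (l2 / l1) + (eta2 * l2 ^+ 2) / (eta1 * l1 ^+ 2)) * M1
    - (3 + 4 * (l1 / l2) + (eta1 * l1 ^+ 2) / (eta2 * l2 ^+ 2)) * M2 != 0)
  (xe ye : R) (the : circle R)
  (W : set (state R)) (W_nbhs : nbhs ((xe, ye, the, angle 0) : state R) W)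
  (T eps : R) (T_gt0 : 0 < T) (eps_gt0 : 0 < eps) :
  let P := Swimmer l1 l2 xi1 xi2 eta1 eta2 kappa M1 M2 in
  exists V : set (state R),
    [/\ nbhs ((xe, ye, the, angle 0) : state R) V, V `<=` W &
      forall zi zf : state R, V zi -> V zf ->
      exists Hpar Hperp : R -> R,
        [/\ [/\ measurable_fun `[0, T] Hpar, measurable_fun `[0, T] Hperp,
                [bounded Hpar t | t in `[0, T]] &
                [bounded Hperp t | t in `[0, T]]],
            (Linfty_norm T Hperp < eps%:E)%E,
            (Linfty_norm T Hpar
               < (2 * kappa * `|(M2 + M1) / (M2 * M1)| + eps)%:E)%E,
            exists z : R -> state R, solution P T Hpar Hperp z /\ z 0 = zi &
            forall z : R -> state R, solution P T Hpar Hperp z -> z 0 = zi ->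
              z T = zf /\ forall t, t \in `[0, T] -> W (z t)]].
Proof.
move=> P.
have dee0 : 0 < eta1 * l1 + eta2 * l2 by rewrite addr_gt0// mulr_gt0.
have dxx0 : 0 < xi1 * l1 + xi2 * l2 by rewrite addr_gt0// mulr_gt0.
have nondeg : torque_balance P 1 0 0 != 0.
  rewrite torque_balance_rotation0//= mulf_neq0//.
  apply: mulf_neq0; last by rewrite invr_eq0 !mulf_neq0// ?gt_eqF.
  by rewrite !mulf_neq0// ?expf_neq0// gt_eqF.
pose D := - (l1 * l2 / (2 * (xi1 * l1 + xi2 * l2) * (eta1 * l1 + eta2 * l2))
      * (eta2 * l2 * (eta1 - xi1) + eta1 * l1 * (eta2 - xi2))).
have curv : D != 0.
  rewrite oppr_eq0 mulf_neq0//.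
    by apply: lt0r_neq0; apply: divr_gt0; rewrite ?mulr_gt0.
  have a2 : 0 <= eta2 * l2 * (eta1 - xi1) by rewrite !mulr_ge0 ?subr_ge0// ltW.
  have a1 : 0 <= eta1 * l1 * (eta2 - xi2) by rewrite !mulr_ge0 ?subr_ge0// ltW.
  rewrite paddr_eq0// !mulf_eq0 (gt_eqF eta1_gt0) (gt_eqF eta2_gt0).
  rewrite (gt_eqF l1_gt0) (gt_eqF l2_gt0) /=.
  by move: anisotropic; rewrite xpair_eqE.
have [the0 theE] := angle_surj the.
rewrite theE in W_nbhs *.
have [rW rW0 hW] := nbhs_state_box W_nbhs.
have e0 : 0 < eps / 4 by rewrite divr_gt0.
have [r [A [r0 r1 A0 hctl]]] := @controls_small R P l1_gt0 l2_gt0 xi1_gt0 xi2_gt0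
  eta1_gt0 eta2_gt0 kappa_gt0 M1_neq0 M2_neq0 nondeg _ e0.
have [B hB] : exists B, forall a, [/\ `|bodyU P (gait_slope P) 1 a| <= B,
    `|bodyW P (gait_slope P) 1 a| <= B, `|bodyU P 1 0 a| <= B & `|bodyW P 1 0 a| <= B].
  have [B1 h1] := @body_bounded R P l1_gt0 l2_gt0 xi1_gt0 xi2_gt0 eta1_gt0 eta2_gt0
    (gait_slope P) 1.
  have [B2 h2] := @body_bounded R P l1_gt0 l2_gt0 xi1_gt0 xi2_gt0 eta1_gt0 eta2_gt0 1 0.
  have B10 : 0 <= B1 by have [h _] := h1 0; exact: le_trans h.
  have B20 : 0 <= B2 by have [h _] := h2 0; exact: le_trans h.
  have [le1 le2] : B1 <= B1 + B2 /\ B2 <= B1 + B2 by rewrite lerDl lerDr.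
  exists (B1 + B2) => a; have [u1 w1] := h1 a; have [u2 w2] := h2 a.
  by split; [exact: le_trans le1|exact: le_trans le1|exact: le_trans le2|exact: le_trans le2].
have B0 : 0 <= B by have [h _ _ _] := hB 0; exact: le_trans h.
(* Throughout, the state stays within s of the equilibrium: s / 2 for the initial
   state and s / 2 for the distance covered in time T. *)
pose s := Num.min r rW.
have s0 : 0 < s by rewrite lt_min r0.
have [sr sW] : s <= r /\ s <= rW by rewrite !ge_min !lexx orbT.
pose G := 2 * B + `|gait_slope P| + 1.
have G0 : 0 < G by rewrite ltr_wpDl// addr_ge0// mulr_ge0.
(* The size of the inputs: G * rho bounds the speed, A * rho enters the bounds on
   the fields. *)
pose rho := Num.min (s / 2 / (G * T)) (eps / 4 / A).
have rho0 : 0 < rho by rewrite lt_min !divr_gt0// mulr_gt0.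
have GT : G * rho * T <= s / 2.
  rewrite mulrAC mulrC -ler_pdivlMr ?mulr_gt0//.
  by rewrite ge_min lexx.
have Arho : A * rho <= eps / 4.
  by rewrite mulrC -ler_pdivlMr// ge_min lexx orbT.
(* The number of phases of [reach_near]. *)
pose d := T / 29.
have d0 : 0 < d by rewrite divr_gt0.
have [X [Y [X0 Y0 hXY]]] := @shape_path R P l1_gt0 l2_gt0 xi1_gt0 xi2_gt0 eta1_gt0 eta2_gt0.
have dpiv : is_derive (0 : R) 1 (pivotY P Y) D.
  have dY0 : is_derive (0 : R) 1 Y (shapeY' P 0) by have [|_] := hXY 0; rewrite ?normr0.
  exact: (@is_derive_pivotY R P l1_gt0 l2_gt0 xi1_gt0 xi2_gt0 eta1_gt0 eta2_gt0 Y dY0).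
have m0 : 0 < Num.min 1 (rho * d) by rewrite lt_min ltr01 mulr_gt0.
have [a [a0 ab apiv]] := derive_neq0_asymmetric dpiv curv m0.
have ha : amplitude rho d a.
  move: ab; rewrite lt_min => /andP[a1 ard].
  split; rewrite ?gtr0_norm//; first exact: ltW.
  by rewrite gt_eqF// sin_gt0_pi// a0/=; move: (pi_ge2 R) a1; clear; lra.
have [tau tau0 htau] := @reach_near R P X Y hXY B rho (ltW rho0) hB X0 Y0 rho0 d d0 a ha apiv.
pose r' := Num.min (tau / 2) (s / 2).
have r'0 : 0 < r' by rewrite lt_min !divr_gt0.
have [r'tau r's] : r' <= tau / 2 /\ r' <= s / 2 by rewrite !ge_min !lexx orbT.
exists (state_box xe ye the0 r'); split.
- exact: state_box_nbhs.
- by apply: subset_trans hW; apply: state_box_sub; move: r's s0 sW; clear; lra.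
move=> _ _ [xi [yi [thi [ali [-> xib yib [thib alib]]]]]] [xf [yf [thf [alf [-> xfb yfb [thfb alfb]]]]]].
have near2 (p q u : R) : `|p - u| < r' -> `|q - u| < r' -> `|q - p| <= tau.
  move=> pu qu; have -> : q - p = (q - u) - (p - u) by ring.
  by apply: le_trans (ler_normB _ _) _; move: r'tau pu qu; clear; lra.
have alt (b : R) : `|b| < r' -> `|b| <= tau by move: r'tau tau0; clear; lra.
have := htau xi yi thi ali xf yf thf alf (near2 _ _ _ xib xfb) (near2 _ _ _ yib yfb)
  (near2 _ _ _ thib thfb) (alt _ alib) (alt _ alfb) 0.
rewrite add0r (_ : 29%:R * d = T); last by rewrite /d mulrC divfK.
move=> [x [y [th [al [v [p [mot qi qf]]]]]]].
move: (qi) (qf) => [x0E y0E th0E al0E] [xTE yTE thTE alTE].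
have [[Lx Ly Lt La] _ vp _] := mot.
have stay (f : R -> R) (u : R) : lipschitz_itv (G * rho) 0 T f -> `|f 0 - u| < r' ->
    forall t, 0 <= t <= T -> `|f t - u| < s.
  move=> Lf fu t tT; have -> : f t - u = (f t - f 0) + (f 0 - u) by ring.
  apply: le_lt_trans (ler_normD _ _) _.
  have : `|f t - f 0| <= G * rho * `|t - 0| by apply: Lf => //; rewrite lexx ltW.
  have [t0 tle] := andP tT.
  rewrite subr0 (ger0_norm t0); have : G * rho * t <= G * rho * T.
    by rewrite ler_wpM2l// mulr_ge0// ltW.
  by move: GT r's fu; clear; lra.
have xs := stay x xe Lx; rewrite x0E in xs.
have ys := stay y ye Ly; rewrite y0E in ys.
have ths := stay th the0 Lt; rewrite th0E in ths.
have als := stay al 0 La; rewrite al0E subr0 in als.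
have alr t : 0 <= t <= T -> `|al t| <= r.
  by move=> /(als alib); rewrite subr0 => /ltW /le_trans; apply.
have ali_pi : `|al 0| < pi by rewrite al0E; move: (pi_ge2 R) r's sr r1 alib; clear; lra.
have hctl' t : 0 <= t <= T -> _ := fun tT =>
  hctl rho (al t) (v t) (p t) (alr t tT) (vp t).1 (vp t).2.
have [bd n1 n2 sol uniq] := @motion_realized R P l1_gt0 l2_gt0 xi1_gt0 xi2_gt0
  eta1_gt0 eta2_gt0 T rho _ B _ _ x y th al v p T_gt0 hB mot ali_pi hctl'.
exists (fun t => Hpar_of P (al t) (v t) (p t)), (fun t => Hperp_of P (al t) (v t) (p t)).
split => //.
- by apply: le_lt_trans n1 _; rewrite lte_fin; move: Arho eps_gt0; clear; lra.
- by apply: le_lt_trans n2 _; rewrite lte_fin /=; move: Arho eps_gt0; clear; lra.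
- by eexists; split; [exact: sol|rewrite /= x0E y0E th0E al0E].
move=> z zsol z0.
have zE t : 0 <= t <= T -> _ := uniq z zsol _ t.
have {}zE t : 0 <= t <= T -> z t = (x t, y t, angle (th t), angle (al t)).
  by apply: zE; rewrite z0 x0E y0E th0E al0E.
split; first by rewrite zE ?xTE ?yTE ?thTE ?alTE// lexx ltW.
move=> t; rewrite in_itv/= => tT; apply: hW; rewrite zE//.
exists (x t), (y t), (th t), (al t); split=> //.
- exact: lt_le_trans (xs xib t tT) sW.
- exact: lt_le_trans (ys yib t tT) sW.
- split; first exact: lt_le_trans (ths thib t tT) sW.
  by have := als alib t tT; rewrite subr0 => /lt_le_trans; apply.
Qed.
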